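(* Let $P$ be a finite poset, $\Bbbk$ a field, and let $R = \{1\}\times R_1 \cup \{2\} \times R_2 \subseteq [2]\times P$. The multigraded Betti number $\beta_{i,R}(L(2,P))$ is the dimension (over $\Bbbk$) of $$\widetilde{H}^{|R|-i-2}(X(R),\Bbbk) \cong \widetilde{H}^{|R|-i-3}(Y_1(R),\Bbbk) \cong \widetilde{H}^{|R|-i-3}(Y_2(R),\Bbbk).$$
   Context: $[2]=\{1,2\}$. The letterplace ideal $L(2,P)$ is the ideal in $S=\Bbbk[x_{i,p} : (i,p)\in[2]\times P]$ generated by the monomials $x_{1,p_1}x_{2,p_2}$ with $p_1\le p_2$ in $P$. For $R\subseteq [2]\times P$, $\beta_{i,R}(L(2,P)) = \dim_\Bbbk \mathrm{Tor}_i^S(L(2,P),\Bbbk)_R$, where the multidegree $R$ means the $0/1$ exponent vector with support $R$ (so generators of the ideal are in homological degree $0$). Let $\max(R_1)$ be the set of maximal elements of $R_1$ and $\min(R_2)$ the set of minimal elements of $R_2$ (with the poset structures induced from $P$). Consider the bipartite graph on the disjoint union of $\max(R_1)$ and $\min(R_2)$ (an element of $P$ lying in both sets gives two vertices, i.e. the vertex set is $\{1\}\times\max(R_1)\cup\{2\}\times\min(R_2)$) with an edge between $p_1\in\max(R_1)$ and $p_2\in\min(R_2)$ iff $p_1\le p_2$ in $P$. $X(R)$ is the simplicial complex whose Stanley-Reisner ideal is the edge ideal of this graph, i.e. its faces are the sets of vertices containing no edge. $Y_2(R)$ is the simplicial complex on $\min(R_2)$ consisting of all $B\subseteq\min(R_2)$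 such that there is $a\in\max(R_1)$ with $a\not\le b$ for all $b\in B$. $Y_1(R)$ is the simplicial complex on $\max(R_1)$ consisting of all $A\subseteq\max(R_1)$ such that there is $b\in\min(R_2)$ with $a\not\le b$ for all $a\in A$. $\widetilde H$ denotes reduced cohomology, including degree $-1$.
   Formalization: The isomorphism of the cohomology of X(R) with that of Y_1(R) is claimed except when R_1 is empty and R_2 is not, and with that of Y_2(R) except when R_2 is empty and R_1 is not; in those cases it fails in general, as Y_1(R) (resp. Y_2(R)) is {∅} while X(R) is a simplex. *)

(* Defs.v *)
From HB Require Import structures.
From mathcomp Require Import all_boot all_order all_algebra.
From mathcomp Require Import mpoly.

Set Implicit Arguments.
Unset Strict Implicit.
Unset Printing Implicit Defensive.

Import Order.TTheory GRing.Theory.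
Local Open Scope ring_scope.

Section VectorSpaces.
Variable k : fieldType.

(* Homology at [B] of [A --f--> B --g--> C] with [g \o f = 0].  There is no
   quotient of a vectType in MathComp; [lker g / limg f] is represented by the
   complement of [limg f] in [lker g] provided by [diffv]. *)
Definition homology_space (A B C : vectType k) (f : 'Hom(A, B)) (g : 'Hom(B, C))
  : {vspace B} := (lker g :\: limg f)%VS.

Definition vspace_isom (V W : vectType k) (A : {vspace V}) (B : {vspace W}) :=
  exists f : 'Hom(subvs_of A, subvs_of B), bijective f.

End VectorSpaces.

Section MultigradedTor.
Variables (k : fieldType) (n : nat).
Local Notation S := {mpoly k[n]}.

(* An N^n-graded free resolution of an ideal [I] of S by free modules of finite
   rank.  [F_i = S^(rk i)] consists of row vectors, its [r]-th basis vector has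
   multidegree [mdg r], and [diff i : F_(i+1) -> F_i] and [aug : F_0 -> S] act
   by right multiplication.  Tor_i(I, k) is computed below from an arbitrary
   such resolution, on whose choice it does not depend. *)
Record graded_free_resolution (I : S -> Prop) := GradedFreeResolution {
  rk : nat -> nat;
  mdg : forall i, 'I_(rk i) -> 'X_{1..n};
  diff : forall i, 'M[S]_(rk i.+1, rk i);
  aug : 'cV[S]_(rk 0);
  diff_homog : forall i r s m,
    m \in msupp (diff i r s) -> (m + mdg s)%MM = mdg r;
  aug_homog : forall r m, m \in msupp (aug r ord0) -> m = mdg r;
  aug_image : forall f : S, I f <-> exists v : 'rV_(rk 0), v *m aug = f%:M;
  exact0 : forall v : 'rV_(rk 0),
    v *m aug = 0 <-> exists w : 'rV_(rk 1), v = w *m diff 0;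
  exactS : forall i (v : 'rV_(rk i.+1)),
    v *m diff i = 0 <-> exists w : 'rV_(rk i.+2), v = w *m diff i.+1
}.

Variables (I : S -> Prop) (F : graded_free_resolution I) (R : 'X_{1..n}).

(* The component of multidegree [R] of the complex [F (x)_S k]: a basis of
   [(F_i (x)_S k)_R] is given by the basis vectors of [F_i] of multidegree [R],
   and [diff] acts through the constant terms of its entries. *)
Definition fiber i : vectType k :=
  {ffun {r : 'I_(rk F i) | mdg r == R} -> k^o}.

Definition fiber_diff_fun i (u : fiber i.+1) : fiber i :=
  [ffun s => \sum_r u r * (diff F i (val r) (val s))@_0%MM].

Fact fiber_diff_is_linear i : linear (@fiber_diff_fun i).
Proof.
move=> a u v; apply/ffunP=> s; rewrite !ffunE scaler_sumr -big_split /=.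
by apply: eq_bigr => r _; rewrite !ffunE mulrDl -scalerAl.
Qed.

HB.instance Definition _ i :=
  GRing.isLinear.Build k (fiber i.+1) (fiber i) _ (@fiber_diff_fun i)
    (@fiber_diff_is_linear i).

Definition fiber_diff i : 'Hom(fiber i.+1, fiber i) :=
  linfun (@fiber_diff_fun i).

Definition Tor i : {vspace fiber i} :=
  match i with
  | 0 => homology_space (fiber_diff 0) (0 : 'Hom(fiber 0, k^o))
  | j.+1 => homology_space (fiber_diff j.+1) (fiber_diff j)
  end.

Definition betti i : nat := \dim (Tor i).

End MultigradedTor.

Section SimplicialCohomology.
Variable V : finType.

(* [V] need not be the set of vertices: singletons may fail to be faces.  Both
   the void complex and the complex [{set0}] are allowed. *)
Record scomplex := SComplex {
  faces :> {set {set V}};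
  facesS : forall A B : {set V}, A \subset B -> B \in faces -> A \in faces
}.

Variables (k : fieldType) (K : scomplex).

Local Notation simplex d :=
  {A : {set V} | (A \in faces K) && (#|A|%:Z == d + 1)}.

Definition cochain (d : int) : vectType k :=
  {ffun simplex d -> k^o}.

(* Vertices are ordered by [enum_rank]. *)
Definition incidence (A : {set V}) (v : V) : k :=
  (-1) ^+ #|[set w in A | (enum_rank w < enum_rank v)%N]|.

Definition cochain_val d (u : cochain d) (A : {set V}) : k :=
  oapp u 0 (insub A).

(* Only meant for [e = d + 1]. *)
Definition coboundary_fun d e (u : cochain d) : cochain e :=
  [ffun A : simplex e => \sum_(v in (val A : {set V}))
     incidence (val A) v * cochain_val u (val A :\ v)].

Fact coboundary_is_linear d e : linear (@coboundary_fun d e).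
Proof.
move=> a u w; apply/ffunP=> A; rewrite !ffunE scaler_sumr -big_split /=.
apply: eq_bigr => v _; rewrite /cochain_val; case: insub => [B|] /=.
  by rewrite !ffunE mulrDr scalerAr.
by rewrite mulr0 scaler0 addr0.
Qed.

HB.instance Definition _ d e :=
  GRing.isLinear.Build k (cochain d) (cochain e) _ (@coboundary_fun d e)
    (@coboundary_is_linear d e).

Definition coboundary d e : 'Hom(cochain d, cochain e) :=
  linfun (@coboundary_fun d e).

Definition red_cohomology (d : int) : {vspace cochain d} :=
  homology_space (coboundary (d - 1) d) (coboundary d (d + 1)).

End SimplicialCohomology.

Section Letterplace.
Variables (k : fieldType) (disp : Order.disp_t) (P : finPOrderType disp).

(* The element [(1, p)], respectively [(2, p)], of [2] x P. *)
Definition fst_letter (p : P) : 'I_2 * P := (ord0, p).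
Definition snd_letter (p : P) : 'I_2 * P := (ord_max, p).

Local Notation N := #|{: 'I_2 * P}|.

Definition lp_var (z : 'I_2 * P) : {mpoly k[N]} := 'X_(enum_rank z).

Definition letterplace (f : {mpoly k[N]}) : Prop :=
  exists c : P -> P -> {mpoly k[N]},
    f = \sum_p \sum_(q | (p <= q)%O)
          c p q * (lp_var (fst_letter p) * lp_var (snd_letter q)).

Definition support_mdeg (R : {set 'I_2 * P}) : 'X_{1..N} :=
  [multinom (enum_val j \in R : nat) | j < N].

Definition max_elts (A : {set P}) : {set P} :=
  [set p in A | [forall q in A, (p <= q)%O ==> (q == p)]].
Definition min_elts (A : {set P}) : {set P} :=
  [set p in A | [forall q in A, (q <= p)%O ==> (q == p)]].

Variables R1 R2 : {set P}.

Definition letters : {set 'I_2 * P} :=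
  (fst_letter @: R1) :|: (snd_letter @: R2).

Definition X_vertices : {set 'I_2 * P} :=
  (fst_letter @: max_elts R1) :|: (snd_letter @: min_elts R2).

Definition X_faces : {set {set 'I_2 * P}} :=
  [set A : {set 'I_2 * P} | (A \subset X_vertices) &&
     [forall p, forall q, (fst_letter p \in A) && (snd_letter q \in A)
        ==> ~~ (p <= q)%O]].

Definition Y1_faces : {set {set P}} :=
  [set A : {set P} | (A \subset max_elts R1) &&
     [exists b in min_elts R2, forall a in A, ~~ (a <= b)%O]].

Definition Y2_faces : {set {set P}} :=
  [set B : {set P} | (B \subset min_elts R2) &&
     [exists a in max_elts R1, forall b in B, ~~ (a <= b)%O]].

Fact X_facesS (A B : {set 'I_2 * P}) :
  A \subset B -> B \in X_faces -> A \in X_faces.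
Proof.
move=> sAB; rewrite !inE => /andP[sBV /forallP noE].
rewrite (subset_trans sAB sBV); apply/forallP=> p; apply/forallP=> q.
apply/implyP=> /andP[Ap Aq]; move/forallP/(_ q)/implyP: (noE p); apply.
by rewrite !(subsetP sAB).
Qed.

Fact Y1_facesS (A B : {set P}) :
  A \subset B -> B \in Y1_faces -> A \in Y1_faces.
Proof.
move=> sAB; rewrite !inE => /andP[sBV /exists_inP[b b_min /forall_inP nle]].
rewrite (subset_trans sAB sBV); apply/exists_inP; exists b => //.
by apply/forall_inP=> a Aa; apply: nle; apply: (subsetP sAB).
Qed.

Fact Y2_facesS (A B : {set P}) :
  A \subset B -> B \in Y2_faces -> A \in Y2_faces.
Proof.
move=> sAB; rewrite !inE => /andP[sBV /exists_inP[b b_max /forall_inP nle]].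
rewrite (subset_trans sAB sBV); apply/exists_inP; exists b => //.
by apply/forall_inP=> a Aa; apply: nle; apply: (subsetP sAB).
Qed.

Definition X_complex := SComplex X_facesS.
Definition Y1_complex := SComplex Y1_facesS.
Definition Y2_complex := SComplex Y2_facesS.

End Letterplace.

(* Main.v *)
Require Import Defs.
From HB Require Import structures.
From mathcomp Require Import all_boot all_order all_algebra.
From mathcomp Require Import mpoly.

(** Why the theorem holds.

    Fix a squarefree degree R. Setting all variables to 1 turns the component of
    degree B of a graded free module, for B contained in R, into the space spanned
    by the basis vectors whose degree divides B; multiplication by a variable
    becomes an inclusion. A graded module is thus seen as an increasing system of
    subspaces indexed by the subsets of R, and its Koszul complex in degree R is
    the complex of simplicial cochains with coefficients in that system.

    For a free module, a basis vector of degree m different from R only sees the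
    sets B with m <= B <= R, which form a cone, so the cochains are acyclic except
    in top degree, where they compute the fiber of the module in degree R
    ([free_acyclic], [free_top_lift]). Dimension shifting along the syzygies of an
    arbitrary resolution ([syz_shift], [TorS_iso]) therefore identifies Tor_i in
    degree R with the cohomology, in degree |R| - 1 - i, of the sets B whose
    monomial lies in the ideal. This is Hochster's formula, [betti_cohom].

    For the letterplace ideal these sets are those containing an edge of the
    comparability graph between R1 and R2. They are the complement of the
    independent sets in the simplex on R, which lowers the degree by one
    ([edge_X_iso]). A letter whose element is not extremal is dominated by an
    extremal one, so the independence complex retracts to X ([letterplace_fold]).
    Finally X is made of the simplex on one side of a bipartite graph and, over
    every face of Y, a simplex on the other side; hence X is a suspension of Y
    ([suspension_iso]).

    All comparisons are linear correspondences between subquotients ([sq_iso]):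
    these compose, and in finite dimension they preserve the dimension. *)

Set Implicit Arguments.
Unset Strict Implicit.
Unset Printing Implicit Defensive.
Import Order.TTheory GRing.Theory Num.Theory.
Local Open Scope ring_scope.

(** * Subquotients and linear correspondences *)

Record subquotient (k : fieldType) := Subquotient {
  sq_space : lmodType k;
  sq_num : sq_space -> Prop;
  sq_den : sq_space -> Prop
}.
Arguments sq_num {k} s x.
Arguments sq_den {k} s x.

Section SubquotientIso.
Variable k : fieldType.
Implicit Types S : subquotient k.

Record sq_corr S S' (rho : sq_space S -> sq_space S' -> Prop) : Prop := SqCorr {
  corr_num : forall x y, rho x y -> sq_num S x /\ sq_num S' y;
  corr_lin : forall a x x' y y',
    rho x y -> rho x' y' -> rho (a *: x + x') (a *: y + y');
  corr_total : forall x, sq_num S x -> exists y, rho x y;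
  corr_onto : forall y, sq_num S' y -> exists x, rho x y;
  corr_den : forall x y, rho x y -> (sq_den S x <-> sq_den S' y)
}.

(** Isomorphisms of subquotients are given by linear relations because the
    comparison maps of homological algebra are only defined up to choices of
    lifts; relations compose without making those choices. *)
Definition sq_iso S S' := exists rho, @sq_corr S S' rho.

Lemma sq_iso_sym S S' : sq_iso S S' -> sq_iso S' S.
Proof.
case=> rho [rn rl rt ro rd]; exists (fun y x => rho x y); split=> //.
- by move=> y x /rn[].
- by move=> a x x' y y'; apply: rl.
- by move=> x y /rd[? ?].
Qed.

Lemma sq_iso_trans S S' S'' : sq_iso S S' -> sq_iso S' S'' -> sq_iso S S''.
Proof.
case=> rho [rn rl rt ro rd] [sig [sn sl st so sd]].
exists (fun x z => exists2 y, rho x y & sig y z); split.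
- by move=> x z [y /rn[Zx _] /sn[_ Zz]].
- move=> a x x' z z' [y rxy syz] [y' rxy' syz'].
  by exists (a *: y + y'); [apply: rl | apply: sl].
- by move=> x /rt[y rxy]; have [_ /st[z syz]] := rn _ _ rxy; exists z, y.
- by move=> z /so[y syz]; have [/ro[x rxy] _] := sn _ _ syz; exists x, y.
- by move=> x z [y /rd xy /sd yz]; rewrite xy.
Qed.

Lemma corr0 S S' rho : @sq_corr S S' rho -> sq_num S 0 -> rho 0 0.
Proof.
move=> c /(corr_total c)[y r0y].
by have := corr_lin c (-1) r0y r0y; rewrite !scaleN1r !addNr.
Qed.

Lemma sq_iso_map S S' (f : {linear sq_space S -> sq_space S'}) :
  (forall a x y, sq_num S x -> sq_num S y -> sq_num S (a *: x + y)) ->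
  (forall x, sq_num S x -> sq_num S' (f x)) ->
  (forall y, sq_num S' y -> exists2 x, sq_num S x & f x = y) ->
  (forall x, sq_num S x -> (sq_den S x <-> sq_den S' (f x))) ->
  sq_iso S S'.
Proof.
move=> lS fS onto den; exists (fun x y => sq_num S x /\ f x = y); split.
- by move=> x y [Zx <-]; split=> //; apply: fS.
- by move=> a x x' y y' [Zx <-] [Zx' <-]; split; [apply: lS | rewrite linearP].
- by move=> x Zx; exists (f x).
- by move=> y /onto[x Zx <-]; exists x.
- by move=> x y [Zx <-]; apply: den.
Qed.

Lemma sq_iso_trivial S S' :
  sq_num S 0 -> sq_num S' 0 ->
  (forall a x x', sq_num S x -> sq_num S x' -> sq_num S (a *: x + x')) ->
  (forall a x x', sq_num S' x -> sq_num S' x' -> sq_num S' (a *: x + x')) ->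
  (forall x, sq_num S x -> sq_den S x) ->
  (forall x, sq_num S' x -> sq_den S' x) -> sq_iso S S'.
Proof.
move=> n0 n0' lS lS' dS dS'.
exists (fun x y => sq_num S x /\ sq_num S' y); split=> //.
- by move=> a x x' y y' [? ?] [? ?]; split; auto.
- by move=> x Zx; exists 0.
- by move=> x Zx; exists 0.
- by move=> x y [/dS ? /dS' ?].
Qed.

End SubquotientIso.

Section SubquotientDim.
Variable k : fieldType.

Definition sq_of_vspace (V : vectType k) (Z B : {vspace V}) : subquotient k :=
  @Subquotient k V (fun x => x \in Z) (fun x => x \in B).

Lemma sq_iso_dim_le (V W : vectType k) (Z B : {vspace V}) (Z' B' : {vspace W}) :
  sq_iso (sq_of_vspace Z B) (sq_of_vspace Z' B') ->
  (\dim (Z :\: B) <= \dim (Z' :\: B'))%N.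
Proof.
case=> rho c; set X := vbasis (Z :\: B)%VS; set n := \dim _ in X *.
have rX (i : 'I_n) : exists y, rho X`_i y.
  apply: (corr_total c); apply: (subvP (diffvSl _ B)).
  by rewrite vbasis_mem // mem_nth ?size_tuple.
have [y ry] := fin_all_exists rX.
have rsum (a : 'I_n -> k) : rho (\sum_i a i *: X`_i) (\sum_i a i *: y i).
  elim/big_ind2: _ => [|u v u' v' r r'|i _].
  - by apply: (corr0 c); rewrite /= mem0v.
  - by rewrite -[u]scale1r -[v]scale1r; apply: (corr_lin c).
  - have r0 : rho 0 0 by apply: (corr0 c); rewrite /= mem0v.
    by have := corr_lin c (a i) (ry i) r0; rewrite !addr0.
pose Y := [tuple y i | i < n].
have den0 (a : 'I_n -> k) : \sum_i a i *: y i \in B' -> forall i, a i = 0.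
  move=> yB'; have xB : \sum_i a i *: X`_i \in B.
    by have /= [_ ->] := corr_den c (rsum a).
  have xD : \sum_i a i *: X`_i \in (Z :\: B)%VS.
    by apply: rpred_sum => i _; rewrite rpredZ ?vbasis_mem ?mem_nth ?size_tuple.
  have : \sum_i a i *: X`_i \in ((Z :\: B) :&: B)%VS by rewrite memv_cap xD.
  rewrite capv_diff memv0 => /eqP; apply/freeP.
  by apply: basis_free (vbasisP _).
have Ynth (i : 'I_n) : Y`_i = y i by rewrite -tnth_nth tnth_mktuple.
have freeY : free Y.
  apply/freeP => a sa0; apply: den0.
  suff -> : \sum_i a i *: y i = 0 by rewrite mem0v.
  by rewrite -[RHS]sa0; apply: eq_bigr => i _; rewrite Ynth.
have YZ : (<<Y>> <= Z')%VS.
  apply/span_subvP => _ /mapP[i _ ->].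
  by have /= [] := corr_num c (ry i).
have disj : (<<Y>> :&: (Z' :&: B'))%VS = 0%VS.
  apply/eqP; rewrite -subv0; apply/subvP => v; rewrite !memv_cap memv0.
  case/and3P=> vY _ vB'; move: vB'; rewrite (coord_span vY) => vB'.
  apply/eqP/big1 => i _; rewrite (den0 (fun j => coord Y j v)) ?scale0r //.
  suff -> : \sum_j coord Y j v *: y j = \sum_j coord Y j v *: Y`_j by [].
  by apply: eq_bigr => j _; rewrite Ynth.
have := dimv_disjoint_sum disj.
rewrite (eqnP freeY) size_tuple => dimS.
rewrite -(leq_add2r (\dim (Z' :&: B'))) -dimS [leqRHS]addnC dimv_cap_compl.
by apply: dimvS; rewrite subv_add YZ capvSl.
Qed.

(** A linear correspondence identifies complements of the denominators, by
    lifting a basis of one of them. *)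
Lemma sq_iso_dim (V W : vectType k) (Z B : {vspace V}) (Z' B' : {vspace W}) :
  sq_iso (sq_of_vspace Z B) (sq_of_vspace Z' B') ->
  \dim (Z :\: B) = \dim (Z' :\: B').
Proof.
move=> iso; apply/eqP; rewrite eqn_leq sq_iso_dim_le //.
exact/sq_iso_dim_le/sq_iso_sym.
Qed.

Lemma vspace_isom_dim (V W : vectType k) (A : {vspace V}) (B : {vspace W}) :
  \dim A = \dim B -> vspace_isom A B.
Proof.
move=> eqd; move: (vbasis A) (vbasisP A) (vbasis B) (vbasisP B).
rewrite -eqd; move: (\dim A) => n X bX Y bY.
pose F (V' W' : vectType k) (A' : {vspace V'}) (B' : {vspace W'})
    (X' : n.-tuple V') (Y' : n.-tuple W') (u : subvs_of A') : subvs_of B' :=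
  \sum_(i < n) coord X' i (vsval u) *: vsproj B' Y'`_i.
have Flin V' W' (A' : {vspace V'}) (B' : {vspace W'}) X' Y' :
    linear (@F V' W' A' B' X' Y').
  move=> a u v; rewrite /F scaler_sumr -big_split /=; apply: eq_bigr => i _.
  by rewrite !linearP scalerDl scalerA.
have FK V' W' (A' : {vspace V'}) (B' : {vspace W'})
      (X' : n.-tuple V') (Y' : n.-tuple W') :
    basis_of A' X' -> basis_of B' Y' ->
    cancel (@F V' W' A' B' X' Y') (@F W' V' B' A' Y' X').
  move=> bX' bY' u; apply: val_inj; rewrite /= {1}/F linear_sum /=.
  rewrite [RHS](coord_basis bX' (subvsP u)); apply: eq_bigr => i _.
  have YB j : (j < n)%N -> Y'`_j \in B'.
    by move=> ltjn; rewrite (basis_mem bY') ?mem_nth ?size_tuple.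
  rewrite vsprojK ?(basis_mem bX') ?mem_nth ?size_tuple //.
  congr (_ *: _); rewrite /F !linear_sum /= (bigD1 i) //= big1 => [|j neji].
    by rewrite addr0 linearZ /= vsprojK ?YB // coord_free ?(basis_free bY') //
      eqxx mulr1.
  by rewrite linearZ /= vsprojK ?YB // coord_free ?(basis_free bY') //
    (negPf neji) mulr0.
pose f : {linear subvs_of A -> subvs_of B} :=
  HB.pack (@F V W A B X Y) (GRing.isLinear.Build _ _ _ _ _ (Flin _ _ A B X Y)).
exists (linfun f); exists (@F W V B A Y X) => u; rewrite lfunE /=; exact: FK.
Qed.

End SubquotientDim.

(** * Cochain complexes and short exact sequences *)

(** All degrees share one ambient space, in which [cdeg d] is the subspace of
    degree d: this avoids transporting cochains along equations between
    degrees. *)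
Record cocomplex (k : fieldType) := Cocomplex {
  cspace : lmodType k;
  cdeg : int -> cspace -> Prop;
  cdiff : {linear cspace -> cspace};
  cdeg0 : forall d, cdeg d 0;
  cdegL : forall d a u v, cdeg d u -> cdeg d v -> cdeg d (a *: u + v);
  cdiff_deg : forall d u, cdeg d u -> cdeg (d + 1) (cdiff u);
  cdiff_sq : forall d u, cdeg d u -> cdiff (cdiff u) = 0
}.
Arguments cdeg {k} c d u.
Arguments cdiff {k} c.

Section Complexes.
Variable k : fieldType.
Implicit Types C : cocomplex k.

Lemma cdegB C d u v : cdeg C d u -> cdeg C d v -> cdeg C d (u - v).
Proof. by move=> Cu Cv; rewrite addrC -scaleN1r; apply: cdegL. Qed.

Lemma cdegD C d u v : cdeg C d u -> cdeg C d v -> cdeg C d (u + v).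
Proof. by move=> Cu Cv; rewrite -[u]scale1r; apply: cdegL. Qed.

Lemma cdiff_deg1 C d u : cdeg C (d - 1) u -> cdeg C d (cdiff C u).
Proof. by move/cdiff_deg; rewrite subrK. Qed.

Definition cocycle C d u := cdeg C d u /\ cdiff C u = 0.
Definition is_cobd C d u := exists2 w, cdeg C (d - 1) w & cdiff C w = u.
Arguments cocycle : clear implicits.
Arguments is_cobd : clear implicits.
Definition cohom C d : subquotient k :=
  Subquotient (cocycle C d) (is_cobd C d).
Definition acyclic C d := forall u, cocycle C d u -> is_cobd C d u.

Lemma cocycle0 C d : cocycle C d 0.
Proof. by split; [apply: cdeg0 | rewrite linear0]. Qed.

Lemma cocycleL C d a u v :
  cocycle C d u -> cocycle C d v -> cocycle C d (a *: u + v).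
Proof.
case=> Cu u0 [Cv v0]; split; first exact: cdegL.
by rewrite linearP u0 v0 scaler0 addr0.
Qed.

Lemma cohom_iso_refl C d : sq_iso (cohom C d) (cohom C d).
Proof.
exists (fun x y => cocycle C d x /\ x = y); split=> //.
- by move=> x y [? <-].
- by move=> a x x' y y' [? <-] [? <-]; split=> //; apply: cocycleL.
- by move=> x ?; exists x.
- by move=> x ?; exists x.
- by move=> x y [_ <-].
Qed.

Lemma cohom_acyclic_iso C C' d d' :
  acyclic C d -> acyclic C' d' -> sq_iso (cohom C d) (cohom C' d').
Proof.
move=> aC aC'; apply: sq_iso_trivial => //=.
- exact: cocycle0.
- exact: cocycle0.
- by move=> *; apply: cocycleL.
- by move=> *; apply: cocycleL.
Qed.

Record short_exact C' C C'' (inj : {linear cspace C' -> cspace C})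
    (prj : {linear cspace C -> cspace C''}) : Prop := ShortExact {
  se_injD : forall d u, cdeg C' d u -> cdiff C (inj u) = inj (cdiff C' u);
  se_inj0 : forall d u, cdeg C' d u -> inj u = 0 -> u = 0;
  se_prj : forall d u, cdeg C d u -> cdeg C'' d (prj u);
  se_prjD : forall d u, cdeg C d u -> cdiff C'' (prj u) = prj (cdiff C u);
  se_ker : forall d u, cdeg C d u -> prj u = 0 ->
    exists2 u', cdeg C' d u' & inj u' = u;
  se_im : forall d u, cdeg C' d u -> cdeg C d (inj u) /\ prj (inj u) = 0;
  se_lift : forall d w, cdeg C'' d w -> exists2 u, cdeg C d u & prj u = w
}.

(** The next four lemmas are the fragments of the long exact cohomology sequence
    of 0 -> C' -> C -> C'' -> 0 in which one of the three complexes is acyclic.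
    Acyclicity is only asked for in the degrees involved, since the free
    modules of a resolution have cohomology in top degree. *)
Section LongExact.
Variables (C' C C'' : cocomplex k).
Variables (inj : {linear cspace C' -> cspace C}).
Variables (prj : {linear cspace C -> cspace C''}).
Hypothesis se : short_exact inj prj.

Lemma connecting_iso d : acyclic C d -> acyclic C (d + 1) ->
  sq_iso (cohom C'' d) (cohom C' (d + 1)).
Proof.
move=> ac ac1.
exists (fun z w => [/\ cocycle C'' d z, cocycle C' (d + 1) w
  & exists m, [/\ cdeg C d m, prj m = z & cdiff C m = inj w]]); split.
- by move=> z w [].
- move=> a z z' w w' [Zz Zw [m [Cm pm dm]]] [Zz' Zw' [m' [Cm' pm' dm']]].
  split; [exact: cocycleL | exact: cocycleL | exists (a *: m + m')].
  by split; rewrite ?linearP ?pm ?pm' ?dm ?dm' //; apply: cdegL.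
- move=> z Zz; have [Cz z0] := Zz; have [m Cm pm] := se_lift se Cz.
  have Cdm := cdiff_deg Cm.
  have [|w Cw iw] := se_ker se Cdm; first by rewrite -(se_prjD se Cm) pm.
  exists w; split=> //; last by exists m.
  split=> //; apply: (se_inj0 se (cdiff_deg Cw)).
  by rewrite -(se_injD se Cw) iw (cdiff_sq Cm).
- move=> w Zw; have [Cw w0] := Zw; have [Ciw piw] := se_im se Cw.
  have [|m] := ac1 (inj w).
    by split=> //; rewrite (se_injD se Cw) w0 linear0.
  rewrite addrK => Cm dm; exists (prj m); split=> //; last by exists m.
  by split; [exact: se_prj se _ _ Cm | rewrite (se_prjD se Cm) dm].
- move=> z w [Zz Zw [m [Cm pm dm]]]; split.
  + case=> z' Cz' dz'; have [m' Cm' pm'] := se_lift se Cz'.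
    have Cdm' := cdiff_deg1 Cm'.
    have [|n Cn inn] := se_ker se (cdegB Cm Cdm').
      by rewrite linearB /= pm -(se_prjD se Cm') pm' dz' subrr.
    exists n; first by rewrite addrK.
    apply/eqP; rewrite -subr_eq0; apply/eqP.
    apply: (se_inj0 se (cdegB (cdiff_deg Cn) (proj1 Zw))).
    by rewrite linearB /= -(se_injD se Cn) inn linearB (cdiff_sq Cm') subr0 dm
      subrr.
  + case=> n; rewrite addrK => Cn dn; have [Cin pin] := se_im se Cn.
    have [|m' Cm' dm'] := ac (m - inj n).
      split; first exact: cdegB.
      by rewrite linearB /= (se_injD se Cn) dn dm subrr.
    exists (prj m'); first exact: se_prj se _ _ Cm'.
    by rewrite (se_prjD se Cm') dm' linearB /= pm pin subr0.
Qed.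

Lemma quotient_iso d : acyclic C' d -> acyclic C' (d + 1) ->
  sq_iso (cohom C d) (cohom C'' d).
Proof.
move=> ac ac1.
have prjZ u : cocycle C d u -> cocycle C'' d (prj u).
  case=> Cu u0; split; first exact: se_prj se _ _ Cu.
  by rewrite (se_prjD se Cu) u0 linear0.
exists (fun z w => cocycle C d z /\ prj z = w); split.
- by move=> z w [Zz <-]; split=> //; apply: prjZ.
- move=> a z z' w w' [Zz <-] [Zz' <-]; split; first exact: cocycleL.
  by rewrite linearP.
- by move=> z Zz; exists (prj z).
- move=> w [Cw w0]; have [m Cm pm] := se_lift se Cw.
  have Cdm := cdiff_deg Cm.
  have [|n Cn inn] := se_ker se Cdm; first by rewrite -(se_prjD se Cm) pm.
  have [|n'] := ac1 n.
    split=> //; apply: (se_inj0 se (cdiff_deg Cn)).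
    by rewrite -(se_injD se Cn) inn (cdiff_sq Cm).
  rewrite addrK => Cn' dn'; have [Cin' pin'] := se_im se Cn'.
  exists (m - inj n'); split; last by rewrite linearB /= pm pin' subr0.
  split; first exact: cdegB.
  by rewrite linearB /= (se_injD se Cn') dn' inn subrr.
- move=> z w [[Cz z0] <-]; split.
  + case=> z' Cz' <-; exists (prj z'); first exact: se_prj se _ _ Cz'.
    by rewrite (se_prjD se Cz').
  + case=> w' Cw' dw'; have [m' Cm' pm'] := se_lift se Cw'.
    have Cdm' := cdiff_deg1 Cm'.
    have [|n Cn inn] := se_ker se (cdegB Cz Cdm').
      by rewrite linearB /= -(se_prjD se Cm') pm' dw' subrr.
    have [|n' Cn' dn'] := ac n.
      split=> //; apply: (se_inj0 se (cdiff_deg Cn)).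
      by rewrite -(se_injD se Cn) inn linearB /= z0 (cdiff_sq Cm') subr0.
    have [Cin' pin'] := se_im se Cn'.
    exists (m' + inj n'); first exact: cdegD.
    by rewrite linearD /= (se_injD se Cn') dn' inn addrC subrK.
Qed.

Lemma subcomplex_iso d : acyclic C'' (d - 1) -> acyclic C'' d ->
  sq_iso (cohom C' d) (cohom C d).
Proof.
move=> ac1 ac.
have injZ u : cocycle C' d u -> cocycle C d (inj u).
  case=> Cu u0; split; first by have [] := se_im se Cu.
  by rewrite (se_injD se Cu) u0 linear0.
exists (fun w z => exists2 u, cocycle C' d w /\ cdeg C (d - 1) u
  & z = inj w + cdiff C u); split.
- move=> w _ [u [Zw Cu] ->]; split=> //; split.
    by apply: cdegD; [have [] := injZ _ Zw | apply: cdiff_deg1].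
  by rewrite linearD /= (cdiff_sq Cu) addr0; have [] := injZ _ Zw.
- move=> a w w' _ _ [u [Zw Cu] ->] [u' [Zw' Cu'] ->].
  exists (a *: u + u'); first by split; [apply: cocycleL | apply: cdegL].
  by rewrite !linearP scalerDr addrACA.
- move=> w Zw; exists (inj w), 0; last by rewrite linear0 addr0.
  by split=> //; apply: cdeg0.
- move=> z [Cz z0]; have [|w' Cw' dw'] := ac (prj z).
    split; first exact: se_prj se _ _ Cz.
    by rewrite (se_prjD se Cz) z0 linear0.
  have [m' Cm' pm'] := se_lift se Cw'.
  have [|w Cw iw] := se_ker se (cdegB Cz (cdiff_deg1 Cm')).
    by rewrite linearB /= -(se_prjD se Cm') pm' dw' subrr.
  exists w, m'; last by rewrite iw subrK.
  split=> //; split=> //; apply: (se_inj0 se (cdiff_deg Cw)).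
  by rewrite -(se_injD se Cw) iw linearB /= z0 (cdiff_sq Cm') subr0.
- move=> w _ [u [[Cw w0] Cu] ->]; split.
  + case=> n Cn <-; have [Cin _] := se_im se Cn.
    exists (inj n + u); first exact: cdegD.
    by rewrite linearD /= (se_injD se Cn).
  + case=> m Cm dm.
    have Cmu := cdegB Cm Cu.
    have dmu : cdiff C (m - u) = inj w by rewrite linearB /= dm addrK.
    have [|v Cv dv] := ac1 (prj (m - u)).
      split; first exact: se_prj se _ _ Cmu.
      by rewrite (se_prjD se Cmu) dmu; have [] := se_im se Cw.
    have [v' Cv' pv'] := se_lift se Cv.
    have [|n Cn inn] := se_ker se (cdegB Cmu (cdiff_deg1 Cv')).
      by rewrite linearB /= -(se_prjD se Cv') pv' dv subrr.
    exists n => //; apply/eqP; rewrite -subr_eq0; apply/eqP.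
    apply: (se_inj0 se (cdegB (cdiff_deg1 Cn) Cw)).
    by rewrite linearB /= -(se_injD se Cn) inn linearB dmu (cdiff_sq Cv') subr0
      subrr.
Qed.

Lemma acyclic_ext d : acyclic C' d -> acyclic C'' d -> acyclic C d.
Proof.
move=> ac' ac z [Cz z0]; have [|w' Cw' dw'] := ac (prj z).
  split; first exact: se_prj se _ _ Cz.
  by rewrite (se_prjD se Cz) z0 linear0.
have [m' Cm' pm'] := se_lift se Cw'.
have [|w Cw iw] := se_ker se (cdegB Cz (cdiff_deg1 Cm')).
  by rewrite linearB /= -(se_prjD se Cm') pm' dw' subrr.
have [|n Cn dn] := ac' w.
  split=> //; apply: (se_inj0 se (cdiff_deg Cw)).
  by rewrite -(se_injD se Cw) iw linearB /= z0 (cdiff_sq Cm') subr0.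
have [Cin _] := se_im se Cn.
exists (inj n + m'); first exact: cdegD.
by rewrite linearD /= (se_injD se Cn) dn iw subrK.
Qed.

End LongExact.
End Complexes.

Arguments cocycle {k} C d u.
Arguments is_cobd {k} C d u.

(** * Simplicial cochains with coefficients *)

Section Incidence.
Variables (k : fieldType) (T : finType).
Implicit Types (A B C : {set T}) (v w : T).
Local Notation inc := (incidence k).

Lemma incidence_sqr A v : inc A v * inc A v = 1.
Proof. by rewrite /incidence -expr2 sqrr_sign. Qed.

(** Deleting v from C changes the number of elements of C before w exactly when
    v comes before w, so the two orders of deletion differ by one sign. *)
Lemma incidence_swap C v w : v \in C -> w \in C -> v != w ->
  inc C v * inc (C :\ v) w = - (inc C w * inc (C :\ w) v).
Proof.
wlog ltwv : v w / (enum_rank w < enum_rank v)%N.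
  move=> IH Cv Cw nevw; case: (ltngtP (enum_rank w) (enum_rank v)) => [lt|lt|eq].
  - exact: IH.
  - by rewrite (IH w v) ?opprK // eq_sym.
  - by case/eqP: nevw; apply/enum_rank_inj/val_inj.
move=> Cv Cw nevw; rewrite mulrC -mulrN; congr (_ * _).
  rewrite /incidence; congr (_ ^+ _); apply: eq_card => x; rewrite !inE.
  case: (eqVneq x v) => [->|//]; by rewrite ltnNge (ltnW ltwv) !andbF.
rewrite /incidence (cardsD1 w) !inE Cw ltwv exprS mulN1r; congr (- (_ ^+ _)).
by apply: eq_card => x; rewrite !inE andbA.
Qed.
End Incidence.

Section Cochains.
Variables (k : fieldType) (T : finType).
Implicit Types (A B C : {set T}) (G : {set {set T}}).
Local Notation inc := (incidence k).

(** A convex family is a difference of two simplicial complexes, and its cochains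
    are the relative cochains of that pair. *)
Definition convex_family G := forall A B C,
  A \subset B -> B \subset C -> A \in G -> C \in G -> B \in G.

Definition delta (L : lmodType k) G (u : {ffun {set T} -> L})
    : {ffun {set T} -> L} :=
  [ffun B => if B \in G then \sum_(v in B) inc B v *: u (B :\ v) else 0].

Fact delta_is_linear (L : lmodType k) G : linear (@delta L G).
Proof.
move=> a u w; apply/ffunP=> B; rewrite !ffunE.
case: (B \in G); last by rewrite scaler0 addr0.
rewrite scaler_sumr -big_split; apply: eq_bigr => v _ /=.
by rewrite !ffunE scalerDr !scalerA mulrC.
Qed.

HB.instance Definition _ (L : lmodType k) G :=
  GRing.isLinear.Build k {ffun {set T} -> L} {ffun {set T} -> L} _ (@delta L G)
    (@delta_is_linear L G).

(** A system of subspaces of L indexed by the subsets of T, which increases on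
    the convex family [cf_dom] and vanishes outside of it. *)
Record coeffs (L : lmodType k) := Coeffs {
  cf_dom : {set {set T}};
  cf :> {set T} -> L -> Prop;
  cf_convex : convex_family cf_dom;
  cf0 : forall B, cf B 0;
  cfL : forall B a x y, cf B x -> cf B y -> cf B (a *: x + y);
  cf_mono : forall A B x, A \subset B -> B \in cf_dom -> cf A x -> cf B x;
  cf_out : forall B x, cf B x -> x != 0 -> B \in cf_dom
}.

Section Complex.
Variables (L : lmodType k) (M : coeffs L).

Lemma cfZ B a x : M B x -> M B (a *: x).
Proof. by move=> Mx; rewrite -[_ *: _]addr0; apply: cfL => //; apply: cf0. Qed.

Lemma cfD B x y : M B x -> M B y -> M B (x + y).
Proof. by move=> Mx My; rewrite -[x]scale1r; apply: cfL. Qed.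

Lemma cfB B x y : M B x -> M B y -> M B (x - y).
Proof. by move=> Mx My; rewrite addrC -scaleN1r; apply: cfL. Qed.

Lemma cf_sum I r (P : pred I) B (F : I -> L) :
  (forall i, P i -> M B (F i)) -> M B (\sum_(i <- r | P i) F i).
Proof. by move=> MF; elim/big_ind: _ => //; [apply: cf0 | apply: cfD]. Qed.

Definition cochain_deg (d : int) (u : {ffun {set T} -> L}) :=
  forall B, M B (u B) /\ (u B != 0 -> #|B|%:Z = d + 1).

Fact cochain_deg0 d : cochain_deg d 0.
Proof. by move=> B; rewrite ffunE eqxx; split=> //; apply: cf0. Qed.

Fact cochain_degL d a u v :
  cochain_deg d u -> cochain_deg d v -> cochain_deg d (a *: u + v).
Proof.
move=> Cu Cv B; have [Mu du] := Cu B; have [Mv dv] := Cv B.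
rewrite !ffunE; split; first exact: cfL.
case: (eqVneq (u B) 0) => [->|/du //].
by rewrite scaler0 add0r.
Qed.

Fact delta_deg d u : cochain_deg d u -> cochain_deg (d + 1) (delta (cf_dom M) u).
Proof.
move=> Cu B; rewrite ffunE; case: ifP => [GB|_]; last first.
  by rewrite eqxx; split=> //; apply: cf0.
split.
  apply: cf_sum => v _; apply: cfZ.
  exact: cf_mono (subD1set B v) GB (proj1 (Cu _)).
move=> nz; have [v Bv nzv] : exists2 v, v \in B & u (B :\ v) != 0.
  apply/exists_inP; apply: contra_neqT nz => /exists_inPn u0.
  by apply: big1 => v /u0/negPn/eqP ->; rewrite scaler0.
by rewrite -((Cu _).2 nzv) (cardsD1 v B) Bv addnC PoszD.
Qed.

Fact delta_sq d u :
  cochain_deg d u -> delta (cf_dom M) (delta (cf_dom M) u) = 0.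
Proof.
move=> Cu; apply/ffunP=> C; rewrite !ffunE; case: ifP => // GC.
pose F v w := inc C v *: (inc (C :\ v) w *: u (C :\ v :\ w)).
have in_dom v w : v \in C -> w \in C :\ v -> u (C :\ v :\ w) != 0 ->
    C :\ v \in cf_dom M.
  move=> Cv Cw /(cf_out (Cu _).1) Gvw.
  exact: (cf_convex (subD1set _ w) (subD1set _ v) Gvw GC).
(* By convexity the test for membership of C :\ v may be dropped. *)
transitivity (\sum_(v in C) \sum_(w in C | w != v) F v w).
  apply: eq_bigr => v Cv; rewrite ffunE.
  have memD1 w : (w \in C) && (w != v) = (w \in C :\ v) by rewrite !inE andbC.
  rewrite (eq_bigl _ _ memD1) -scaler_sumr; case: ifP => // GCv.
  rewrite big1 // => w Cw; apply/eqP; rewrite scaler_eq0; apply/orP; right.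
  by apply: contraFT GCv => /(in_dom _ _ Cv Cw).
rewrite pair_big_dep /=.
(* Pair (v, w) with (w, v). *)
pose lt (v w : T) := (enum_rank v < enum_rank w)%N.
rewrite (bigID (fun p => lt p.1 p.2)) /=.
have swapI : injective (fun p : T * T => (p.2, p.1)).
  by move=> [? ?] [? ?] [-> ->].
rewrite [X in _ + X](reindex_inj swapI) /=.
rewrite [X in _ + X](eq_bigl (fun p => [&& p.1 \in C, p.2 \in C & p.2 != p.1]
    && lt p.1 p.2)); last first.
  case=> v w; rewrite /lt /=; case: (eqVneq w v) => [->|nevw].
    by rewrite !andbF.
  rewrite !andbT -leqNgt leq_eqVlt val_eqE (inj_eq enum_rank_inj).
  by rewrite eq_sym (negPf nevw) /= [(w \in C) && _]andbC.
rewrite -big_split big1 //= => -[v w] /andP[/and3P[/= Cv Cw newv] _].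
rewrite /F !scalerA incidence_swap 1?eq_sym // scaleNr.
suff -> : C :\ v :\ w = C :\ w :\ v by rewrite addNr.
by apply/setP=> x; rewrite !inE andbCA.
Qed.

Definition cochains : cocomplex k :=
  @Cocomplex k {ffun {set T} -> L} cochain_deg (@delta L (cf_dom M))
    cochain_deg0 cochain_degL delta_deg delta_sq.

End Complex.

Section KernelCoefficients.
Variables (L L'' : lmodType k) (M : coeffs L) (f : {linear L -> L''}).

Definition ker_cf (B : {set T}) x := M B x /\ f x = 0.

Fact ker_cf0 B : ker_cf B 0.
Proof. by split; [apply: cf0 | rewrite linear0]. Qed.

Fact ker_cfL B a x y : ker_cf B x -> ker_cf B y -> ker_cf B (a *: x + y).
Proof.
case=> Mx fx [My fy]; split; first exact: cfL.
by rewrite linearP fx fy scaler0 addr0.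
Qed.

Fact ker_cf_mono A B x :
  A \subset B -> B \in cf_dom M -> ker_cf A x -> ker_cf B x.
Proof. by move=> sAB DB [Mx fx]; split=> //; apply: cf_mono Mx. Qed.

Fact ker_cf_out B x : ker_cf B x -> x != 0 -> B \in cf_dom M.
Proof. by case=> Mx _; apply: cf_out. Qed.

Definition ker_coeffs : coeffs L :=
  @Coeffs L (cf_dom M) ker_cf (@cf_convex _ M) ker_cf0 ker_cfL ker_cf_mono
    ker_cf_out.

End KernelCoefficients.
End Cochains.

(** * Scalar cochains on a convex family of sets *)

Section Families.
Variables (k : fieldType) (T : finType).
Implicit Types (A B : {set T}) (G U : {set {set T}}).
Local Notation inc := (incidence k).

Definition fam_coeff G (B : {set T}) (x : k^o) := x != 0 -> B \in G.

Fact fam_coeffL G B a (x y : k^o) :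
  fam_coeff G B x -> fam_coeff G B y -> fam_coeff G B (a *: x + y).
Proof.
move=> Gx Gy nz; case: (eqVneq x 0) => [x0|/Gx //].
by apply: Gy; move: nz; rewrite x0 scaler0 add0r.
Qed.

Fact fam_coeff0 G B : fam_coeff G B 0.
Proof. by rewrite /fam_coeff eqxx. Qed.

Fact fam_coeff_mono G A B x :
  A \subset B -> B \in G -> fam_coeff G A x -> fam_coeff G B x.
Proof. by move=> _ GB _ _. Qed.

Definition fam G (cG : convex_family G) : coeffs T k^o :=
  @Coeffs k T k^o G (fam_coeff G) cG (@fam_coeff0 G) (@fam_coeffL G)
    (@fam_coeff_mono G) (fun B x Gx => Gx).

Definition fam_cochains G (cG : convex_family G) := cochains (fam cG).

Lemma fam_degP G (cG : convex_family G) d (u : {ffun {set T} -> k^o}) :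
  (forall B, u B != 0 -> B \in G /\ #|B|%:Z = d + 1) <->
  cdeg (fam_cochains cG) d u.
Proof.
split=> [Cu B | Cu B nz]; first by split=> [nz|nz]; have [] := Cu B nz.
by split; have [Mu du] := Cu B; [apply: Mu | apply: du].
Qed.

Lemma empty_degree_acyclic G (cG : convex_family G) d :
  (forall B, B \in G -> #|B|%:Z != d + 1) -> acyclic (fam_cochains cG) d.
Proof.
move=> noB u [/fam_degP Cu _]; exists 0; first exact: cdeg0.
rewrite linear0; apply/ffunP=> B; rewrite ffunE; apply/esym/eqP.
by apply: contraT => /Cu[/noB /eqP].
Qed.

Lemma delta_cochain_sub G U (u : {ffun {set T} -> k^o}) :
    U \subset G -> (forall A B, A \subset B -> A \in U -> B \in G -> B \in U) ->
    (forall B, u B != 0 -> B \in U) ->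
  delta G u = delta U u.
Proof.
move=> sUG upU Uu; apply/ffunP=> B; rewrite !ffunE.
case: (boolP (B \in U)) => [/(subsetP sUG) ->// | nUB].
case: ifP => // GB; apply: big1 => v _.
case: (eqVneq (u (B :\ v)) 0) => [->|/Uu Uv]; first by rewrite scaler0.
by rewrite (upU _ _ (subD1set B v) Uv GB) in nUB.
Qed.

(** The apex v gives a contracting homotopy, which evaluates a cochain on the
    sets with v added. *)
Lemma cone_acyclic G (cG : convex_family G) (v : T) :
  (forall B, v \notin B -> (v |: B \in G) = (B \in G)) ->
  forall d, acyclic (fam_cochains cG) d.
Proof.
move=> coneG d u [/fam_degP Cu /ffunP u0].
pose w : {ffun {set T} -> k^o} :=
  [ffun B : {set T} => if v \in B then 0 else inc (v |: B) v * u (v |: B)].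
exists w.
  apply/fam_degP => B; rewrite ffunE; case: ifP; rewrite ?eqxx // => nBv.
  rewrite mulf_eq0 negb_or => /andP[_ /Cu]; rewrite coneG ?nBv //.
  by rewrite cardsU1 nBv subrK PoszD [_ + #|B|%:Z]addrC => -[? /addIr].
apply/ffunP=> B; rewrite [LHS]ffunE; case: ifP => [GB|nGB]; last first.
  by apply/esym/eqP; apply: contraFT nGB => /Cu[].
case: (boolP (v \in B)) => [Bv|nBv].
  rewrite (big_setD1 v) //= big1 => [|x /setD1P[nexv Bx]]; last first.
    by rewrite ffunE !inE Bv eq_sym nexv scaler0.
  rewrite addr0 ffunE !inE eqxx setD1K //=.
  by rewrite -[_ *: _]/(_ * _) mulrA incidence_sqr mul1r.
have := u0 (v |: B); rewrite !ffunE coneG // GB big_setU1 //= => /eqP.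
rewrite addr_eq0 setU1K // -![_ *: _]/(_ * _) => /eqP eq_u.
rewrite -[RHS]mul1r -(incidence_sqr k (v |: B) v) -mulrA eq_u mulrN mulr_sumr.
rewrite -sumrN; apply: eq_bigr => x Bx.
have nexv : v != x by apply: contraNneq nBv => ->.
have nBxv : v \notin B :\ x by rewrite !inE (negPf nBv) andbF.
have eqS : (v |: B) :\ x = v |: (B :\ x).
  by apply/setP=> y; rewrite !inE; case: (eqVneq y v) => [->|//]; rewrite nexv.
rewrite ffunE (negPf nBxv) -![_ *: _]/(_ * _) -eqS !mulrA -mulNr.
congr (_ * _).
have := incidence_swap k (setU11 v B) (setU1r v Bx) nexv.
rewrite setU1K // => eqi.
rewrite -[inc B x]mul1r -(incidence_sqr k (v |: B) v) -[inc _ v * _ * _]mulrA eqi.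
by rewrite mulrN !mulNr -!mulrA incidence_sqr mulr1.
Qed.

Definition erase U (u : {ffun {set T} -> k^o}) : {ffun {set T} -> k^o} :=
  [ffun B : {set T} => if B \in U then 0 else u B].

Fact erase_is_linear U : linear (@erase U).
Proof.
move=> a u w; apply/ffunP=> B; rewrite !ffunE.
by case: ifP => // _; rewrite scaler0 addr0.
Qed.

HB.instance Definition _ U :=
  GRing.isLinear.Build k {ffun {set T} -> k^o} {ffun {set T} -> k^o} _ (@erase U)
    (@erase_is_linear U).

Lemma fam_short_exact G U D (cG : convex_family G) (cU : convex_family U)
    (cD : convex_family D) :
    U \subset G -> (forall A B, A \subset B -> A \in U -> B \in G -> B \in U) ->
    D = G :\: U ->
  @short_exact k (fam_cochains cU) (fam_cochains cG) (fam_cochains cD)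
    (@idfun {ffun {set T} -> k^o}) (@erase U).
Proof.
move=> sUG upU eD; split=> //=.
- move=> d u /fam_degP Cu; apply: delta_cochain_sub => // B nz.
  by have [] := Cu B nz.
- move=> d u /fam_degP Cu; apply/fam_degP=> B; rewrite ffunE.
  by case: ifP; rewrite ?eqxx // eD inE => -> /Cu.
- move=> d u /fam_degP Cu; apply/ffunP=> B; rewrite !ffunE eD inE.
  case: (boolP (B \in U)) => //= nUB; case: ifP => // GB.
  apply: eq_bigr => v _.
  rewrite ffunE; case: ifP => // Uv.
  by rewrite (upU _ _ (subD1set B v) Uv GB) in nUB.
- move=> d u /fam_degP Cu /ffunP u0; exists u => //; apply/fam_degP=> B nz.
  have [GB dB] := Cu B nz; split=> //.
  by have := u0 B; rewrite !ffunE; case: ifP => // _ /eqP; rewrite (negPf nz).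
- move=> d u /fam_degP Cu; split.
    by apply/fam_degP=> B /Cu[/(subsetP sUG)].
  apply/ffunP=> B; rewrite !ffunE; case: ifP => // nUB.
  by apply/eqP; apply: contraFT nUB => /Cu[].
- move=> d w /fam_degP Cw; exists w.
    by apply/fam_degP=> B /Cw[]; rewrite eD inE => /andP[].
  apply/ffunP=> B; rewrite !ffunE; case: ifP => // UB.
  apply/esym/eqP; apply: contraTT UB => /Cw[].
  by rewrite eD inE => /andP[].
Qed.

Lemma convex_up G U : convex_family G -> U \subset G ->
  (forall A B, A \subset B -> A \in U -> B \in G -> B \in U) -> convex_family U.
Proof.
move=> cG sUG upU A B C sAB sBC UA UC; apply: (upU A) => //.
by apply: (cG A B C) => //; apply: (subsetP sUG).
Qed.

Lemma convex_diff_up G U : convex_family G ->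
  (forall A B, A \subset B -> A \in U -> B \in G -> B \in U) ->
  convex_family (G :\: U).
Proof.
move=> cG upU A B C sAB sBC; rewrite !inE => /andP[_ GA] /andP[nUC GC].
rewrite (cG A B C) // andbT; apply: contra nUC => UB.
exact: (upU B).
Qed.

Lemma convex_down G :
  (forall A B, A \subset B -> B \in G -> A \in G) -> convex_family G.
Proof. by move=> dG A B C _ sBC _; apply: dG. Qed.

(** If every nonempty fibre of B |-> B :&: S on G is a cone, then G is acyclic:
    the fibre over a trace of maximal cardinality is closed upwards, so it
    contributes a subcomplex, and the rest of G is acyclic by induction. *)
Lemma fibrewise_cone_acyclic (S : {set T}) G (cG : convex_family G) :
  (forall A, A \in G -> exists2 v, v \notin S &
     forall B, B :&: S = A :&: S -> v \notin B -> (v |: B \in G) = (B \in G)) ->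
  forall d, acyclic (fam_cochains cG) d.
Proof.
have [n] := ubnP #|G|; elim: n G cG => // n IH G cG leGn coneG d.
have [G0|[A0 GA0]] := set_0Vmem G.
  move=> u [/fam_degP Cu _]; exists 0; first exact: cdeg0.
  rewrite linear0; apply/ffunP=> B; rewrite ffunE; apply/esym/eqP.
  by apply: contraT => /Cu; rewrite G0 inE => -[].
case: (arg_maxnP (fun A => #|A :&: S|) GA0) => A GA maxA {A0 GA0}.
pose U := [set B in G | B :&: S == A :&: S].
have sUG : U \subset G by apply/subsetP=> B; rewrite inE => /andP[].
have upU (B C : {set T}) : B \subset C -> B \in U -> C \in G -> C \in U.
  move=> sBC; rewrite !inE => /andP[GB /eqP eB] GC; rewrite GC /= eq_sym.
  by rewrite eqEcard -eB setSI //= eB; apply: maxA.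
have cU := convex_up cG sUG upU.
have cD := convex_diff_up cG upU.
apply: (acyclic_ext (fam_short_exact cG cU cD sUG upU erefl)).
  have [v nSv cone] := coneG A GA.
  apply: (@cone_acyclic _ _ v) => B nBv; rewrite !inE.
  have -> : (v |: B) :&: S = B :&: S.
    apply/setP=> x; rewrite !inE; case: eqVneq => [->|//].
    by rewrite (negPf nSv) !andbF.
  by case: eqP => [eB|]; rewrite ?andbF // !andbT cone.
apply: IH => [|A'].
  rewrite ltnS in leGn; apply: leq_trans leGn; apply: proper_card.
  apply/properP; split.
    exact: subsetDl.
  by exists A => //; rewrite !inE eqxx andbT (GA : A \in G).
rewrite !inE => /andP[nUA' GA']; have [v nSv cone] := coneG A' GA'.
exists v => // B eB nBv; rewrite !inE.
have -> : (v |: B) :&: S = B :&: S.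
  apply/setP=> x; rewrite !inE; case: eqVneq => [->|//].
  by rewrite (negPf nSv) !andbF.
by move: nUA'; rewrite GA' eB /= => /negPf->; rewrite !andbF cone.
Qed.

End Families.

Section CoefficientSequence.
Variables (k : fieldType) (T : finType) (L L'' : lmodType k).
Variable f : {linear L -> L''}.

Definition map_cochain (u : {ffun {set T} -> L}) : {ffun {set T} -> L''} :=
  [ffun B : {set T} => f (u B)].

Fact map_cochain_is_linear : linear map_cochain.
Proof. by move=> a u w; apply/ffunP=> B; rewrite !ffunE linearP. Qed.

HB.instance Definition _ :=
  GRing.isLinear.Build k {ffun {set T} -> L} {ffun {set T} -> L''} _ map_cochain
    map_cochain_is_linear.

Lemma delta_map G u : delta G (map_cochain u) = map_cochain (delta G u).
Proof.
apply/ffunP=> B; rewrite !ffunE; case: ifP => _; last by rewrite linear0.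
by rewrite linear_sum; apply: eq_bigr => v _; rewrite ffunE linearZ.
Qed.

(** The domain of the quotient M'' may be smaller: this happens for the image of
    the augmentation, which is zero on the sets whose monomial is not in the
    ideal. *)
Variables (M' M : coeffs T L) (M'' : coeffs T L'').
Hypothesis dom' : cf_dom M' = cf_dom M.
Hypothesis dom'' : cf_dom M'' \subset cf_dom M.
Hypothesis ker_f : forall B x, M' B x <-> M B x /\ f x = 0.
Hypothesis im_f : forall B y, M'' B y <-> exists2 x, M B x & f x = y.

Lemma cochain_liftP d (w : {ffun {set T} -> L''}) :
  cdeg (cochains M'') d w ->
  exists2 u, cdeg (cochains M) d u & map_cochain u = w.
Proof.
move=> Cw.
have lift B : exists x, [/\ M B x, f x = w B & (w B = 0 -> x = 0)].
  have [Mw _] := Cw B; case: (eqVneq (w B) 0) => [->|nz].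
    by exists 0; split=> //; [apply: cf0 | rewrite linear0].
  have /im_f[x Mx fx] := Mw.
  by exists x; split=> // w0; rewrite w0 eqxx in nz.
have [u Pu] := fin_all_exists lift.
exists (finfun u); last by apply/ffunP=> B; rewrite !ffunE; have [] := Pu B.
move=> B; rewrite ffunE; have [Mu _ u0] := Pu B; split=> // nz.
by apply: (Cw B).2; apply: contra_neq nz => /u0.
Qed.

Lemma coeff_short_exact :
  @short_exact k (cochains M') (cochains M) (cochains M'')
    (@idfun {ffun {set T} -> L}) map_cochain.
Proof.
split=> //=.
- by move=> d u _; rewrite dom'.
- move=> d u Cu B; have [Mu du] := Cu B; rewrite ffunE; split.
    by apply/im_f; exists (u B).
  by move=> nz; apply: du; apply: contra_neq nz => ->; rewrite linear0.
- move=> d u Cu; rewrite -delta_map; apply/ffunP=> B; rewrite !ffunE.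
  case: (boolP (B \in cf_dom M'')) => [/(subsetP dom'') -> // | nDB].
  apply/esym/eqP; apply: contraNT nDB; apply: cf_out.
  have [Mdu _] := delta_deg Cu B; apply/im_f; exists (delta (cf_dom M) u B) => //.
  rewrite ffunE; case: ifP => _; last by rewrite linear0.
  by rewrite linear_sum; apply: eq_bigr => v _; rewrite linearZ ffunE.
- move=> d u Cu /ffunP u0; exists u => // B; have [Mu du] := Cu B; split=> //.
  by apply/ker_f; split=> //; have := u0 B; rewrite !ffunE.
- move=> d u Cu; split.
    by move=> B; have [Mu du] := Cu B; split=> //; have [] := (ker_f _ _).1 Mu.
  apply/ffunP=> B; rewrite !ffunE.
  by have [Mu _] := Cu B; have [] := (ker_f _ _).1 Mu.
- exact: cochain_liftP.
Qed.

End CoefficientSequence.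

(** * Homogeneous matrices *)

Section Homogeneous.
Variables (k : fieldType) (n : nat).
Local Notation S := {mpoly k[n]}.
Implicit Types m : 'X_{1..n}.

Lemma mcoeffMX_out (p : S) e m : ~~ (e <= m)%MM -> (p * 'X_[e])@_m = 0.
Proof.
move=> nle; apply: memN_msupp_eq0; rewrite (perm_mem (msuppMX _ _)).
by apply: contra nle => /mapP[m' _ ->]; apply: lem_addr.
Qed.

Section Row.
Variables (a : nat) (da : 'I_a -> 'X_{1..n}).

(** A vector of degree m in the free module with basis degrees [da] is
    determined by its scalar coefficients: its r-th entry is a multiple of the
    monomial of degree [m - da r]. *)
Definition below m (v : 'rV[k]_a) := forall r, v 0 r != 0 -> (da r <= m)%MM.
Definition homogenize m (v : 'rV[k]_a) : 'rV[S]_a :=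
  \row_r (v 0 r *: 'X_[m - da r]).
Definition hcomp m (w : 'rV[S]_a) : 'rV[k]_a :=
  \row_r (if (da r <= m)%MM then (w 0 r)@_(m - da r) else 0).

Lemma hcomp_below m w : below m (hcomp m w).
Proof. by move=> r; rewrite mxE; case: ifP; rewrite ?eqxx. Qed.

Lemma homogenizeK m v : below m v -> hcomp m (homogenize m v) = v.
Proof.
move=> bv; apply/rowP=> r; rewrite !mxE mcoeffZ mcoeffX eqxx mulr1.
by case: ifP => // nle; apply/esym/eqP; apply: contraFT nle => /bv.
Qed.

End Row.

Section Matrix.
Variables (a b : nat) (da : 'I_a -> 'X_{1..n}) (db : 'I_b -> 'X_{1..n}).
Variable A : 'M[S]_(a, b).
Hypothesis homA : forall r s m, m \in msupp (A r s) -> (m + db s)%MM = da r.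

Definition hcoeff : 'M[k]_(a, b) := \matrix_(r, s) (A r s)@_(da r - db s).

Lemma hcoeff_le r s : hcoeff r s != 0 -> (db s <= da r)%MM.
Proof.
by rewrite mxE -mcoeff_msupp => /homA <-; apply: lem_addl.
Qed.

Lemma hcoeffE r s : A r s = hcoeff r s *: 'X_[da r - db s].
Proof.
apply/mpolyP=> m; rewrite mcoeffZ mcoeffX mxE; case: eqVneq => [<-|ne].
  by rewrite mulr1.
rewrite mulr0; apply: memN_msupp_eq0; apply: contra ne => /homA <-.
by rewrite addmK.
Qed.

Lemma below_mulmx m v : below da m v -> below db m (v *m hcoeff).
Proof.
move=> bv s; rewrite mxE => nz.
have [r] : exists r, v 0 r * hcoeff r s != 0.
  apply/existsP; apply: contra_neqT nz => /existsPn v0.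
  by apply: big1 => r _; apply/eqP/negPn.
rewrite mulf_eq0 negb_or => /andP[/bv ler /hcoeff_le les].
exact: lepm_trans ler.
Qed.

Lemma homogenizeM m v : below da m v ->
  homogenize da m v *m A = homogenize db m (v *m hcoeff).
Proof.
move=> bv; apply/rowP=> s; rewrite [RHS]mxE !mxE scaler_suml.
apply: eq_bigr => r _; rewrite [in LHS]mxE hcoeffE -scalerAl -scalerAr scalerA.
case: (eqVneq (v 0 r) 0) => [->|/bv ler]; first by rewrite !mul0r !scale0r.
case: (eqVneq (hcoeff r s) 0) => [->|/hcoeff_le les].
  by rewrite !mulr0 !scale0r.
rewrite -mpolyXD; congr (_ *: 'X_[_]); apply/mnmP=> j.
have := mnm_lepP ler j; have := mnm_lepP les j; rewrite !mnmE => le1 le2.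
by rewrite addnBA // subnK.
Qed.

Lemma hcompM m w : hcomp db m (w *m A) = hcomp da m w *m hcoeff.
Proof.
apply/rowP=> s; rewrite [RHS]mxE mxE [(w *m A) 0 s]mxE.
rewrite raddf_sum /= -[if _ then _ else _](_ :
  \sum_r (if (db s <= m)%MM then (w 0 r * A r s)@_(m - db s) else 0) = _).
  apply: eq_bigr => r _; rewrite [hcomp _ _ _ _ _]mxE hcoeffE -scalerAr mcoeffZ.
  case: (eqVneq (hcoeff r s) 0) => [->|/hcoeff_le les].
    by rewrite mulr0 mul0r if_same.
  case: ifP => [lesm|nle].
    case: ifP => [lerm|nle].
      rewrite mulrC; congr (_ * _).
      rewrite -[LHS](_ :
        (w 0 r * 'X_[da r - db s])@_(da r - db s + (m - da r)) = _).
        by rewrite mcoeffMX.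
      congr (_@__); apply/mnmP=> j.
      have := mnm_lepP lerm j; have := mnm_lepP les j; rewrite !mnmE => le1 le2.
      by rewrite addnC addnBA // subnK.
    rewrite mul0r mcoeffMX_out ?mulr0 //; apply: contraFN nle => le.
    apply/mnm_lepP=> j; move/mnm_lepP/(_ j): (le); rewrite !mnmE.
    have := mnm_lepP lesm j; have := mnm_lepP les j => le1 le2.
    by rewrite leq_subLR subnKC.
  case: ifP => [lerm|]; last by rewrite mul0r.
  by rewrite (lepm_trans les lerm) in nle.
by case: ifP => // _; rewrite big1.
Qed.

End Matrix.

(** Exactness of graded modules may be tested one degree at a time. *)
Lemma hcoeff_exact a b c (da : 'I_a -> 'X_{1..n}) (db : 'I_b -> 'X_{1..n})
    (dc : 'I_c -> 'X_{1..n}) (A : 'M[S]_(a, b)) (B : 'M[S]_(c, a)) m v :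
  (forall r s m, m \in msupp (A r s) -> (m + db s)%MM = da r) ->
  (forall r s m, m \in msupp (B r s) -> (m + da s)%MM = dc r) ->
  (forall v : 'rV_a, v *m A = 0 <-> exists w : 'rV_c, v = w *m B) ->
  (below da m v /\ v *m hcoeff da db A = 0 <->
   exists2 w, below dc m w & w *m hcoeff dc da B = v).
Proof.
move=> homA homB exAB; split=> [[bv v0] | [w bw <-]].
  have [|w ew] := (exAB (homogenize da m v)).1.
    rewrite (homogenizeM homA bv) v0; apply/rowP=> s.
    by rewrite !mxE scale0r.
  exists (hcomp dc m w); first exact: hcomp_below.
  by rewrite -(hcompM homB) -ew homogenizeK.
have bwB := below_mulmx homB bw; split=> //.
have -> : w *m hcoeff dc da B *m hcoeff da db A
    = hcomp db m (homogenize dc m w *m B *m A).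
  rewrite (homogenizeM homB bw) (homogenizeM homA bwB) homogenizeK //.
  exact: (below_mulmx homA bwB).
have -> : homogenize dc m w *m B *m A = 0.
  by apply/exAB; exists (homogenize dc m w).
by apply/rowP=> s; rewrite !mxE mcoeff0 if_same.
Qed.

End Homogeneous.

(** * Multigraded Betti numbers in squarefree degrees *)

Section SquarefreeDegrees.
Variable T : finType.
Implicit Types (A B R : {set T}).

(** Monomials with exponents at most 1 are identified with sets of variables. *)
Definition chi B : 'X_{1..#|T|} := [multinom (enum_val j \in B : nat) | j < #|T|].

Lemma chiE B v : chi B (enum_rank v) = (v \in B).
Proof. by rewrite mnmE enum_rankK. Qed.

Lemma le_chiP (m : 'X_{1..#|T|}) B :
  reflect (forall v, (m (enum_rank v) <= (v \in B))%N) (m <= chi B)%MM.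
Proof.
apply: (iffP mnm_lepP) => [le v|le j]; first by rewrite -chiE.
by rewrite -[j]enum_valK chiE.
Qed.

Lemma chi_le A B : (chi A <= chi B)%MM = (A \subset B).
Proof.
apply/le_chiP/subsetP => [le v Av|sAB v]; last first.
  by rewrite chiE; case: (boolP (v \in A)) => // /sAB ->.
by have := le v; rewrite chiE Av lt0b.
Qed.

Definition mon_fam R (m : 'X_{1..#|T|}) : {set {set T}} :=
  [set B : {set T} | (B \subset R) && (m <= chi B)%MM].

Lemma mon_fam_sub R m : mon_fam R m \subset powerset R.
Proof. by apply/subsetP=> B; rewrite !inE => /andP[]. Qed.

Lemma mon_fam_up R m A B :
  A \subset B -> A \in mon_fam R m -> B \in powerset R -> B \in mon_fam R m.
Proof.
move=> sAB; rewrite !inE => /andP[_ leA] ->; apply: lepm_trans leA _.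
by rewrite chi_le.
Qed.

Lemma powerset_convex R : convex_family (powerset R).
Proof.
apply: convex_down => A B sAB; rewrite !inE; exact: subset_trans.
Qed.

Lemma mon_fam_convex R m : convex_family (mon_fam R m).
Proof.
exact: convex_up (powerset_convex (R := R)) (mon_fam_sub R m) (@mon_fam_up R m).
Qed.

(** A variable of R that does not divide m is an apex. *)
Lemma mon_fam_acyclic (k : fieldType) R m d : m != chi R ->
  acyclic (fam_cochains k (mon_fam_convex (R := R) (m := m))) d.
Proof.
move=> nem; apply: (@fibrewise_cone_acyclic _ _ set0) => A.
rewrite inE => /andP[sAR leA].
have leR : (m <= chi R)%MM by apply: lepm_trans leA _; rewrite chi_le.
have /exists_inP[v Rv /eqP mv0] : [exists v in R, m (enum_rank v) == 0%N].
  apply: contraNT nem => /exists_inPn m0.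
  apply/eqP/mnmP => j; rewrite -[j]enum_valK chiE.
  have := le_chiP _ _ leR (enum_val j); case: (boolP (_ \in R)) => [/m0|_].
    by case: (m _) => [|[]].
  by rewrite leqn0 => /eqP.
exists v => [|B _ nBv]; first by rewrite inE.
rewrite !inE subUset sub1set Rv /=; congr (_ && _).
apply/le_chiP/le_chiP => le w; have := le w; rewrite !inE.
  by case: eqVneq => // ->; rewrite mv0.
by case: eqVneq => // ->; rewrite mv0.
Qed.

End SquarefreeDegrees.

Section FreeCoefficients.
Variables (k : fieldType) (T : finType) (R : {set T}).
Variables (a : nat) (da : 'I_a -> 'X_{1..#|T|}).
Implicit Types (Q : pred 'I_a) (A B : {set T}) (v : 'rV[k]_a).

(** The components of squarefree degree below R of the free module with basis
    degrees [da], or rather of its summand spanned by the basis vectors in Q.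
    After dehomogenization, multiplication by a variable is an inclusion. *)
Definition free_cf Q B v :=
  forall r, v 0 r != 0 -> [/\ Q r, B \subset R & (da r <= chi B)%MM].

Fact free_cf0 Q B : free_cf Q B 0.
Proof. by move=> r; rewrite mxE eqxx. Qed.

Fact free_cfL Q B c v w :
  free_cf Q B v -> free_cf Q B w -> free_cf Q B (c *: v + w).
Proof.
move=> Fv Fw r; rewrite !mxE; case: (eqVneq (v 0 r) 0) => [->|/Fv //].
by rewrite mulr0 add0r; apply: Fw.
Qed.

Fact free_cf_mono Q A B v :
  A \subset B -> B \in powerset R -> free_cf Q A v -> free_cf Q B v.
Proof.
rewrite inE => sAB sBR Fv r /Fv[Qr _ le]; split=> //.
by apply: lepm_trans le _; rewrite chi_le.
Qed.

Fact free_cf_out Q B v : free_cf Q B v -> v != 0 -> B \in powerset R.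
Proof.
move=> Fv /rV0Pn[r /Fv[_ sBR _]]; by rewrite inE.
Qed.

Definition free_coeffs Q : coeffs T 'rV[k]_a :=
  @Coeffs k T 'rV[k]_a (powerset R) (free_cf Q) (powerset_convex (R := R))
    (@free_cf0 Q) (@free_cfL Q) (@free_cf_mono Q) (@free_cf_out Q).

Definition nontop r := da r != chi R.

Definition coord_cochain (u : {ffun {set T} -> 'rV[k]_a}) r
  : {ffun {set T} -> k^o} := [ffun B : {set T} => u B 0 r].

Lemma delta_coord G u r :
  delta G (coord_cochain u r) = coord_cochain (delta G u) r.
Proof.
apply/ffunP=> B; rewrite !ffunE; case: ifP => _; last by rewrite mxE.
by rewrite summxE; apply: eq_bigr => v _; rewrite !mxE ffunE.
Qed.

(** The cochains split along the basis, and each basis vector contributes the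
    cochains of a family [mon_fam]. *)
Lemma free_nontop_acyclic d : acyclic (cochains (free_coeffs nontop)) d.
Proof.
move=> u [Cu u0].
have cochain_r r : cdeg (fam_cochains k (mon_fam_convex (R := R) (m := da r))) d
    (coord_cochain u r).
  apply/fam_degP=> B; rewrite ffunE => nz; have [Fu du] := Cu B.
  have [_ sBR le] := Fu r nz; rewrite inE sBR le; split=> //; apply: du.
  by apply: contraNneq nz => ->; rewrite mxE.
have prim r : exists w : {ffun {set T} -> k^o},
    [/\ cdeg (fam_cochains k (mon_fam_convex (R := R) (m := da r))) (d - 1) w,
        delta (powerset R) w = coord_cochain u r
      & ~~ nontop r -> w = 0].
  case: (boolP (nontop r)) => [nt|tr]; last first.
    exists 0; split=> //; first exact: cdeg0.
    rewrite linear0; apply/ffunP=> B; rewrite !ffunE; apply/esym/eqP.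
    by apply: contraNT tr => nz; have [] := (Cu B).1 r nz.
  have [|w Cw dw] := mon_fam_acyclic (k := k) (d := d) nt (u := coord_cochain u r).
    split=> //; rewrite /= -(@delta_cochain_sub _ _ (powerset R)).
    - by rewrite delta_coord u0; apply/ffunP=> B; rewrite !ffunE mxE.
    - exact: mon_fam_sub.
    - exact: mon_fam_up.
    - by move=> B; move/fam_degP: (cochain_r r) => /[apply] -[].
  exists w; split=> //; rewrite -dw; apply: delta_cochain_sub.
  - exact: mon_fam_sub.
  - exact: mon_fam_up.
  - by move=> B; move/fam_degP: Cw => /[apply] -[].
have [w Pw] := fin_all_exists prim.
exists [ffun B : {set T} => \row_r w r B].
  move=> B; rewrite ffunE; split.
    move=> r; rewrite mxE => nz; have [/fam_degP Cw _ w0] := Pw r.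
    have [] := Cw B nz; rewrite inE => /andP[sBR le] _; split=> //.
    by apply: contraNT nz => /w0 ->; rewrite ffunE.
  move=> /rV0Pn[r]; rewrite mxE => nz; have [/fam_degP Cw _ _] := Pw r.
  by have [] := Cw B nz.
apply/ffunP=> B; apply/rowP=> r; have [_ /ffunP/(_ B) + _] := Pw r.
rewrite [RHS]ffunE => <-; rewrite !ffunE; case: ifP => _; last by rewrite mxE.
by rewrite summxE; apply: eq_bigr => v _; rewrite mxE ffunE mxE.
Qed.

Lemma free_nontop_sub d u : cdeg (cochains (free_coeffs nontop)) d u ->
  cdeg (cochains (free_coeffs predT)) d u.
Proof.
by move=> Cu B; have [Fu du] := Cu B; split=> // r /Fu[_ sBR le].
Qed.

(** Only the basis vectors of degree exactly R obstruct a cone, and they occur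
    in top degree only. *)
Lemma free_acyclic d : d != #|R|%:Z - 1 ->
  acyclic (cochains (free_coeffs predT)) d.
Proof.
move=> ned u [Cu u0].
have [|w Cw dw] := free_nontop_acyclic (d := d) (u := u).
  split=> // B; have [Fu du] := Cu B; split=> // r nz; have [_ sBR le] := Fu r nz.
  split=> //; apply: contra ned => /eqP top; move: le; rewrite top chi_le => sRB.
  have eBR : B = R by apply/eqP; rewrite eqEsubset sBR.
  rewrite -eBR du ?addrK //; apply: contraNneq nz => ->; by rewrite mxE.
by exists w => //; apply: free_nontop_sub.
Qed.

(** In degree R, the boundaries are the elements of the maximal ideal times the
    free module, that is the kernel of the projection to its fiber. *)
Lemma free_top_lift (Y : 'rV[k]_a) : free_cf predT R Y ->
    (forall r, da r = chi R -> Y 0 r = 0) ->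
  exists2 n, cdeg (cochains (free_coeffs predT)) (#|R|%:Z - 1 - 1) n
    & delta (powerset R) n R = Y.
Proof.
move=> FY Y0.
pose u : {ffun {set T} -> 'rV[k]_a} := [ffun B => if B == R then Y else 0].
have [|n Cn dn] := free_nontop_acyclic (d := #|R|%:Z - 1) (u := u).
  split.
    move=> B; rewrite ffunE; case: (eqVneq B R) => [->|_]; last first.
      by split; [exact: free_cf0 | rewrite eqxx].
    split; last by rewrite subrK.
    move=> r nz; have [_ sR le] := FY r nz; split=> //.
    by apply: contraNneq nz => /Y0 ->.
  apply/ffunP=> B; rewrite !ffunE; case: ifP => //; rewrite inE => sBR.
  apply: big1 => v Bv; rewrite ffunE; case: eqP => [eR|_]; last by rewrite scaler0.
  by have := subsetP sBR v Bv; rewrite -eR !inE eqxx.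
exists n; first exact: free_nontop_sub.
by move/ffunP/(_ R): dn; rewrite [u R]ffunE eqxx.
Qed.

Lemma delta_top_coord n r d :
    cdeg (cochains (free_coeffs predT)) d n -> da r = chi R ->
  delta (powerset R) n R 0 r = 0.
Proof.
move=> Cn top; rewrite ffunE inE subxx summxE; apply: big1 => v Rv.
rewrite mxE; apply/eqP; rewrite mulf_eq0; apply/orP; right.
apply: contraT => nz; have [_ _] := (Cn _).1 r nz.
by rewrite top chi_le => /subsetP/(_ v Rv); rewrite !inE eqxx.
Qed.

End FreeCoefficients.

Section TopDegree.
Variables (k : fieldType) (T : finType) (R : {set T}).
Variables (L : lmodType k) (M : coeffs T L).
Hypothesis domR : cf_dom M \subset powerset R.

Lemma cochain_dom_sub d (u : {ffun {set T} -> L}) B :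
  cochain_deg M d u -> u B != 0 -> B \subset R.
Proof.
move=> Cu nz; have := subsetP domR B (cf_out (Cu B).1 nz).
by rewrite inE.
Qed.

Lemma top_cochain_eq0 (u : {ffun {set T} -> L}) :
  cdeg (cochains M) (#|R|%:Z - 1) u -> u R = 0 -> u = 0.
Proof.
move=> Cu uR0; apply/ffunP=> B; rewrite ffunE; apply/eqP.
apply: contraT => nz; have sBR := cochain_dom_sub Cu nz.
have := (Cu B).2 nz; rewrite subrK => -[cardB].
have eBR : B = R by apply/eqP; rewrite eqEcard sBR cardB /=.
by rewrite eBR uR0 eqxx in nz.
Qed.

Lemma above_top_cochain_eq0 (u : {ffun {set T} -> L}) :
  cdeg (cochains M) (#|R|%:Z - 1 + 1) u -> u = 0.
Proof.
move=> Cu; apply/ffunP=> B; rewrite ffunE; apply/eqP.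
apply: contraT => nz; have /subset_leq_card := cochain_dom_sub Cu nz.
have := (Cu B).2 nz; rewrite subrK addrC -PoszD add1n => -[->].
by rewrite ltnn.
Qed.

Lemma top_cochain (x : L) : M R x ->
  cocycle (cochains M) (#|R|%:Z - 1)
    ([ffun B => if B == R then x else 0] : {ffun {set T} -> L}).
Proof.
move=> Mx.
have Cu : cdeg (cochains M) (#|R|%:Z - 1)
    ([ffun B => if B == R then x else 0] : {ffun {set T} -> L}).
  move=> B; rewrite ffunE; case: (eqVneq B R) => [->|_].
    by split=> // _; rewrite subrK.
  by rewrite eqxx; split=> //; apply: cf0.
by split=> //; apply: above_top_cochain_eq0; apply: cdiff_deg Cu.
Qed.

End TopDegree.

Section ResolutionFibers.
Variables (k : fieldType) (n : nat) (I : {mpoly k[n]} -> Prop).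
Variables (F : graded_free_resolution I) (m : 'X_{1..n}).

(** The differential of the resolution after dehomogenization. *)
Definition scalar_diff q : 'M[k]_(rk F q.+1, rk F q) :=
  hcoeff (@mdg _ _ _ F q.+1) (@mdg _ _ _ F q) (diff F q).

Definition fproj q (v : 'rV[k]_(rk F q)) : fiber F m q :=
  [ffun r => v 0 (val r)].

Definition fext q (u : fiber F m q) : 'rV[k]_(rk F q) :=
  \row_r oapp u 0 (insub r).

Fact fproj_is_linear q : linear (@fproj q).
Proof. by move=> a u v; apply/ffunP=> r; rewrite !ffunE !mxE. Qed.

HB.instance Definition _ q :=
  GRing.isLinear.Build k 'rV[k]_(rk F q) (fiber F m q) _ (@fproj q)
    (@fproj_is_linear q).

Lemma fextK q : cancel (@fext q) (@fproj q).
Proof. by move=> u; apply/ffunP=> r; rewrite ffunE mxE valK. Qed.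

Lemma fext_neq0 q (u : fiber F m q) r : fext u 0 r != 0 -> mdg r = m.
Proof.
rewrite mxE; case: insubP => [s /eqP // |_ /=]; by rewrite eqxx.
Qed.

(** Among the basis vectors of degree at most m, only those of degree m map to
    basis vectors of degree m, and they do so through constants. *)
Lemma fiber_diff_proj q (v : 'rV[k]_(rk F q.+1)) :
  below (@mdg _ _ _ F q.+1) m v ->
  fiber_diff F m q (fproj v) = fproj (v *m scalar_diff q).
Proof.
move=> bv; apply/ffunP=> s; rewrite lfunE /= [RHS]ffunE mxE ffunE.
have /eqP ms := valP s.
have mm0 : (m - m)%MM = 0%MM by apply/mnmP=> j; rewrite !mnmE subnn.
rewrite (bigID (fun r => mdg r == m)) /= [X in _ = _ + X]big1 => [|r ner].
  rewrite addr0 (big_sub (fun r => mdg r == m)) /=; apply: eq_bigr => r _.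
  by rewrite ffunE mxE ms (eqP (valP r)) mm0.
case: (eqVneq (v 0 r) 0) => [->|/bv le]; first by rewrite mul0r.
case: (eqVneq (scalar_diff q r (val s)) 0) => [->|nz]; first by rewrite mulr0.
have := hcoeff_le (@diff_homog _ _ _ F q) nz; rewrite ms => ge.
case/eqP: ner; apply/mnmP => j; apply/eqP.
by rewrite eqn_leq (mnm_lepP le) (mnm_lepP ge).
Qed.

End ResolutionFibers.

Section BettiNumbers.
Variables (k : fieldType) (T : finType).
Variables (I : {mpoly k[#|T|]} -> Prop) (F : graded_free_resolution I).
Variables (R : {set T}) (U : {set {set T}}).
Hypothesis UP : forall B, (B \in U) <-> B \subset R /\ I 'X_[chi B].

Local Notation degs q := (@mdg k #|T| I F q).
Local Notation free q := (free_coeffs k R (degs q) predT).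
Local Notation top := (#|R|%:Z - 1).

Lemma free_cf_below q (B : {set T}) v :
  B \subset R -> free q B v <-> below (degs q) (chi B) v.
Proof. by move=> sBR; split=> [Fv r /Fv[] | bv r /bv]. Qed.

Definition aug_matrix : 'M[k]_(rk F 0, 1) :=
  hcoeff (degs 0) (fun=> 0%MM) (aug F).

Lemma aug_matrix_homog r s m :
  m \in msupp (aug F r s) -> (m + 0)%MM = degs 0 r.
Proof. by rewrite ord1 addm0; apply: aug_homog. Qed.

Definition aug_fun (v : 'rV[k]_(rk F 0)) : k^o := (v *m aug_matrix) 0 0.

Fact aug_fun_is_linear : linear aug_fun.
Proof. by move=> a u v; rewrite /aug_fun mulmxDl -scalemxAl !mxE. Qed.

HB.instance Definition _ :=
  GRing.isLinear.Build k 'rV[k]_(rk F 0) k^o _ aug_fun aug_fun_is_linear.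

(** The image of the augmentation in squarefree degrees: dehomogenized, the
    component of the ideal in degree B is the ground field or zero. *)
Lemma dehomog_image (B : {set T}) (y : k) :
  (y != 0 -> B \in U) <-> exists2 v, free 0 B v & aug_fun v = y.
Proof.
split=> [Uy | [v Fv <-] nz].
  case: (eqVneq y 0) => [->|/Uy/UP[sBR IB]].
    by exists 0; [apply: cf0 | rewrite linear0].
  have [w ew] := (aug_image F _).1 IB.
  exists (y *: hcomp (degs 0) (chi B) w).
    apply: cfZ; apply/free_cf_below => //; exact: hcomp_below.
  rewrite linearZ /= /aug_fun -(hcompM aug_matrix_homog) ew !mxE.
  have le0 : (0 <= chi B)%MM by apply/mnm_lepP=> j; rewrite mnmE.
  by rewrite le0 subm0 eqxx mulr1n mcoeffX eqxx -[_ *: _]/(_ * _) mulr1.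
have nzv : v != 0 by apply: contraNneq nz => ->; rewrite linear0.
have sBR : B \subset R by have := free_cf_out Fv nzv; rewrite inE.
apply/UP; split=> //; apply/(aug_image F).
have bv := (free_cf_below v sBR).1 Fv.
exists ((aug_fun v)^-1%:MP *: homogenize (degs 0) (chi B) v).
rewrite -scalemxAl (homogenizeM aug_matrix_homog bv).
have -> : homogenize (fun=> 0%MM) (chi B) (v *m aug_matrix)
    = (aug_fun v *: 'X_[chi B])%:M.
  by apply/rowP=> j; rewrite ord1 [LHS]mxE [RHS]mxE eqxx mulr1n subm0.
by rewrite scale_scalar_mx mul_mpolyC scalerA mulVf ?scale1r.
Qed.

Lemma U_convex : convex_family U.
Proof.
apply: (convex_up (powerset_convex (R := R))).
  by apply/subsetP=> B /UP[sBR _]; rewrite inE.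
move=> A B sAB UA; rewrite inE => sBR.
have [v Fv v1] := (dehomog_image A 1).1 (fun=> UA).
have FvB : free 0 B v by apply: cf_mono Fv => //; rewrite /= inE.
by apply: (dehomog_image B 1).2 (oner_neq0 k); exists v.
Qed.

Definition tgt q : lmodType k :=
  match q with 0 => k^o : lmodType k | p.+1 => 'rV[k]_(rk F p) : lmodType k end.

Definition bd q : {linear 'rV[k]_(rk F q) -> tgt q} :=
  match q return {linear 'rV[k]_(rk F q) -> tgt q} with
  | 0 => aug_fun
  | p.+1 => mulmxr (scalar_diff F p)
  end.

(** The syzygy modules in squarefree degrees below R, the zeroth one being the
    ideal itself. *)
Definition syz q : coeffs T (tgt q) :=
  match q return coeffs T (tgt q) with
  | 0 => fam k U_convex
  | p.+1 => ker_coeffs (free p) (bd p)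
  end.

Lemma syz_dom q : cf_dom (syz q) \subset powerset R.
Proof. by case: q => //=; apply/subsetP=> B /UP[sBR _]; rewrite inE. Qed.

Lemma syz_image q B y : syz q B y <-> exists2 x, free q B x & bd q x = y.
Proof.
case: q y => [|q] y; first exact: dehomog_image.
have ex m v : below (degs q) m v /\ bd q v = 0 <->
    exists2 w, below (degs q.+1) m w & bd q.+1 w = v.
  case: q v {y} => [|q] v /=.
    rewrite -(hcoeff_exact m v aug_matrix_homog (@diff_homog _ _ _ F 0)
      (@exact0 _ _ _ F)).
    split=> -[bv v0]; split=> //; last by rewrite /aug_fun v0 mxE.
    by apply/rowP=> j; rewrite ord1 [RHS]mxE -[RHS]v0.
  exact: (hcoeff_exact m v (@diff_homog _ _ _ F q) (@diff_homog _ _ _ F q.+1)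
    (@exactS _ _ _ F q)).
split=> [[Fy y0] | [x Fx <-]].
  have [yz|nz] := eqVneq y 0.
    by exists 0; [apply: cf0 | rewrite linear0 yz].
  have sBR : B \subset R by have := free_cf_out Fy nz; rewrite inE.
  have [|w bw <-] := (ex (chi B) y).1.
    by split=> //; apply/free_cf_below.
  by exists w => //; apply/free_cf_below.
have [xz|nz] := eqVneq x 0.
  by rewrite xz linear0; apply: cf0.
have sBR : B \subset R by have := free_cf_out Fx nz; rewrite inE.
have [|bx x0] := (ex (chi B) (bd q.+1 x)).2.
  by exists x => //; apply/free_cf_below.
by split=> //; apply/free_cf_below.
Qed.

Lemma syz_exact q :
  @short_exact k (cochains (syz q.+1)) (cochains (free q)) (cochains (syz q))
    (@idfun {ffun {set T} -> 'rV[k]_(rk F q)}) (map_cochain (bd q)).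
Proof.
apply: coeff_short_exact => //; first exact: syz_dom.
by move=> B y; apply: syz_image.
Qed.

(** Dimension shifting: below the top degree, the cochains with coefficients in
    a free module are acyclic. *)
Lemma syz_shift q d : d != top -> d + 1 != top ->
  sq_iso (cohom (cochains (syz q)) d) (cohom (cochains (syz q.+1)) (d + 1)).
Proof.
by move=> ned ned1; apply: (connecting_iso (syz_exact q)); apply: free_acyclic.
Qed.

Lemma syz_shift_iter q :
  sq_iso (cohom (cochains (syz 0)) (top - 1 - q%:Z))
    (cohom (cochains (syz q)) (top - 1)).
Proof.
suff shift p : (p <= q)%N ->
    sq_iso (cohom (cochains (syz 0)) (top - 1 - q%:Z))
      (cohom (cochains (syz p)) (top - 1 - (q - p)%:Z)).
  by have := shift q (leqnn q); rewrite subnn subr0.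
elim: p => [|p IH] ltpq.
  by rewrite subn0; apply: cohom_iso_refl.
apply: sq_iso_trans (IH (ltnW ltpq)) _.
have eqp : (q - p)%:Z = (q - p.+1)%:Z + 1.
  by rewrite -(subnSK ltpq) -[(_ - _).+1]addn1 PoszD.
have -> : top - 1 - (q - p.+1)%:Z = top - 1 - (q - p)%:Z + 1.
  by rewrite eqp opprD addrA subrK.
have below_top j : top - 1 - j%:Z != top.
  by rewrite -addrA -[X in _ != X]addr0 (inj_eq (addrI _)) -opprD oppr_eq0.
by apply: syz_shift; rewrite // eqp opprD [top - 1 + _]addrA subrK.
Qed.


Lemma fproj_top q d m : cdeg (cochains (free q)) d m ->
  fproj (chi R) (delta (powerset R) m R) = 0.
Proof.
move=> Cm; apply/ffunP=> r; rewrite ffunE [RHS]ffunE.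
exact: (delta_top_coord Cm (eqP (valP r))).
Qed.

Lemma fproj_eq0_lift q (Y : 'rV[k]_(rk F q)) :
    free q R Y -> fproj (chi R) Y = 0 ->
  exists2 n, cdeg (cochains (free q)) (top - 1) n & delta (powerset R) n R = Y.
Proof.
move=> FY /ffunP Y0; apply: free_top_lift => // r er.
have /eqP er' := er.
by have := Y0 (Sub r er'); rewrite !ffunE.
Qed.

Lemma fext_free q (u : fiber F (chi R) q) : free q R (fext u).
Proof.
apply/free_cf_below => // r nz; rewrite (fext_neq0 nz); exact: lepm_refl.
Qed.

Lemma free_boundary q (W : 'rV[k]_(rk F q.+1)) :
  free q.+1 R W ->
  free q R (W *m scalar_diff F q) /\ bd q (W *m scalar_diff F q) = 0.
Proof.
move=> FW; suff : syz q.+1 R (W *m scalar_diff F q) by [].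
by apply/syz_image; exists W.
Qed.

Lemma bd_eq0_fproj q (Y : 'rV[k]_(rk F q)) :
  free q R Y -> bd q Y = 0 -> fproj (chi R) Y \in limg (fiber_diff F (chi R) q).
Proof.
move=> FY Y0; have [|W FW eW] := (@syz_image q.+1 R Y).1; first by split.
rewrite -eW /= -fiber_diff_proj; first exact/memv_img/memvf.
exact/free_cf_below.
Qed.

Definition fproj_corr0 (z : {ffun {set T} -> k^o}) (y : fiber F (chi R) 0) :=
  cocycle (cochains (syz 0)) top z /\
  exists Y, [/\ free 0 R Y, aug_fun Y = z R & fproj (chi R) Y = y].

(** In top degree, the cohomology with coefficients in F_0 is the fiber of F_0,
    and right exactness passes to the ideal. *)
Lemma Tor0_iso : sq_iso (cohom (cochains (syz 0)) top)
  (sq_of_vspace (lker (0 : 'Hom(fiber F (chi R) 0, k^o)))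
     (limg (fiber_diff F (chi R) 0))).
Proof.
have se := syz_exact 0.
exists fproj_corr0; split.
- by move=> z y [Zz _]; split=> //=; rewrite memv_ker lfunE.
- move=> a z z' y y' [Zz [Y [FY Yz <-]]] [Zz' [Y' [FY' Yz' <-]]].
  split; first exact: cocycleL.
  exists (a *: Y + Y'); split; first exact: cfL.
    by rewrite linearP /= Yz Yz' !ffunE.
  by rewrite linearP.
- move=> z Zz; have [Mz _] := Zz.1 R.
  have [Y FY Yz] := (@syz_image 0 _ _).1 Mz.
  by exists (fproj (chi R) Y); split=> //; exists Y.
- move=> y _; have FY := @fext_free _ y.
  have MY : syz 0 R (aug_fun (fext y)) by apply/syz_image; exists (fext y).
  exists [ffun B => if B == R then aug_fun (fext y) else 0]; split.
    exact: (top_cochain (syz_dom 0) MY).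
  by exists (fext y); split=> //; [rewrite ffunE eqxx | exact: fextK].
- move=> z y [[Cz z0] [Y [FY Yz <-]]]; split=> /=.
  + case=> z' Cz' dz'; have [m Cm pm] := se_lift se Cz'.
    have Cdm := cdiff_deg1 Cm; have [FdmR _] := Cdm R.
    have zR : z R = bd 0 (delta (powerset R) m R).
      by rewrite -dz' -pm (se_prjD se Cm) ffunE.
    rewrite -[fproj _ Y]subr0 -(fproj_top Cm) -linearB.
    apply: bd_eq0_fproj; first exact: cfB.
    by rewrite linearB /= Yz zR subrr.
  + case/memv_imgP=> w _ eY; have FW := @fext_free _ w.
    have [FWD WD0] := free_boundary FW.
    have [|n Cn dn] := fproj_eq0_lift (cfB FY FWD).
      rewrite linearB /= eY -fiber_diff_proj ?fextK ?subrr //.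
      exact/free_cf_below.
    exists (map_cochain (bd 0) n); first exact: se_prj se _ _ Cn.
    apply/eqP; rewrite -subr_eq0; apply/eqP.
    apply: (top_cochain_eq0 (syz_dom 0)).
      by apply: cdegB Cz; apply: cdiff_deg1; apply: se_prj se _ _ Cn.
    have pnR : map_cochain (bd 0) (delta (powerset R) n) R = z R.
      by rewrite ffunE dn linearB /= -Yz [X in _ - X]WD0 subr0.
    by rewrite (se_prjD se Cn) ffunE [(- _ : {ffun _}) R]ffunE pnR subrr.
Qed.

(** The zigzag z <- m -> Y -> y: lift z to F_i, apply the coboundary, lift to
    F_(i+1) in degree R, and project to the fiber. *)
Definition fproj_corr i (z : {ffun {set T} -> tgt i})
    (y : fiber F (chi R) i.+1) :=
  [/\ cocycle (cochains (syz i)) (top - 1) z, fiber_diff F (chi R) i y = 0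
    & exists m Y, [/\ cdeg (cochains (free i)) (top - 1) m,
        map_cochain (bd i) m = z, free i.+1 R Y,
        Y *m scalar_diff F i = delta (powerset R) m R & fproj (chi R) Y = y]].

(** The last step of the dimension shifting, where the cohomology of F_(i+1) is
    not zero but its fiber. *)
Lemma TorS_iso i : sq_iso (cohom (cochains (syz i)) (top - 1))
  (sq_of_vspace (lker (fiber_diff F (chi R) i))
     (limg (fiber_diff F (chi R) i.+1))).
Proof.
have se := syz_exact i; have se1 := syz_exact i.+1.
exists (@fproj_corr i); split.
- by move=> z y [Zz y0 _]; split=> //=; rewrite memv_ker y0.
- move=> a z z' y y' [Zz y0 [m [Y [Cm pm FY eY pY]]]].
  case=> Zz' y0' [m' [Y' [Cm' pm' FY' eY' pY']]].
  split; [exact: cocycleL | |].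
    by rewrite linearP /=; move: y0 y0' => /= -> ->; rewrite scaler0 addr0.
  exists (a *: m + m'), (a *: Y + Y'); split.
  + exact: cdegL.
  + by rewrite linearP /= pm pm'.
  + exact: cfL.
  + by rewrite mulmxDl -scalemxAl eY eY' linearP [RHS]ffunE [X in _ = X + _]ffunE.
  + by rewrite linearP /= pY pY'.
- move=> z Zz; have [m Cm pm] := se_lift se Zz.1.
  have Cdm := cdiff_deg1 Cm.
  have [|Y FY eY] := (@syz_image i.+1 R (delta (powerset R) m R)).1.
    split; first by have [] := Cdm R.
    have /ffunP/(_ R) := se_prjD se Cm.
    by rewrite pm Zz.2 !ffunE => <-.
  exists (fproj (chi R) Y); split=> //; last by exists m, Y.
  rewrite fiber_diff_proj; last exact/free_cf_below.
  by have /= -> := eY; apply: fproj_top Cm.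
- move=> y; rewrite /= memv_ker => /eqP y0; have FY := @fext_free _ y.
  have [FYD YD0] := free_boundary FY.
  have [|m Cm dm] := fproj_eq0_lift FYD.
    by rewrite -fiber_diff_proj ?fextK //; apply/free_cf_below.
  exists (map_cochain (bd i) m); split=> //.
    have Cz := se_prj se Cm.
    split=> //; apply: (top_cochain_eq0 (syz_dom i) (cdiff_deg1 Cz)).
    by rewrite (se_prjD se Cm) ffunE /= dm.
  by exists m, (fext y); split=> //; apply: fextK.
- move=> z y [[Cz z0] y0 [m [Y [Cm pm FY eY <-]]]]; split=> /=.
  + case=> z' Cz' dz'; have [m' Cm' pm'] := se_lift se Cz'.
    have [|n Cn] := se_ker se (cdegB Cm (cdiff_deg1 Cm')).
      by rewrite linearB /= pm -(se_prjD se Cm') pm' dz' subrr.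
    move=> /= en; have [n1 Cn1 pn1] := se_lift se1 Cn.
    have [FdnR _] := cdiff_deg1 Cn1 R.
    rewrite -[fproj _ Y]subr0 -(fproj_top Cn1) -linearB.
    apply: bd_eq0_fproj; first exact: cfB.
    rewrite linearB /= eY; have /ffunP/(_ R) := se_prjD se1 Cn1.
    rewrite pn1 en [RHS]ffunE /= => <-.
    by rewrite linearB /= (cdiff_sq Cm') subr0 subrr.
  + case/memv_imgP=> w _ ew; have FW := @fext_free _ w.
    have [FWD WD0] := free_boundary FW.
    have [|n Cn dn] := fproj_eq0_lift (cfB FY FWD).
      rewrite linearB /= ew -fiber_diff_proj ?fextK ?subrr //.
      exact/free_cf_below.
    have Cn' := se_prj se1 Cn; have [Cn'' pn''] := se_im se Cn'.
    have Cmn := cdegB Cm Cn''.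
    have ned : top - 1 != top by rewrite -[X in _ != X]addr0 (inj_eq (addrI _)).
    have [|m' Cm' dm'] := free_acyclic ned (u := m - map_cochain (bd i.+1) n).
      split=> //; apply: (@top_cochain_eq0 _ _ R _ (free i)) => //.
        exact: cdiff_deg1 Cmn.
      rewrite linearB /= (delta_map _ _ n) ffunE [(- _ : {ffun _}) R]ffunE.
      rewrite [map_cochain _ _ R]ffunE dn -eY linearB /=.
      by rewrite [X in _ - (_ - X)]WD0 subr0 subrr.
    exists (map_cochain (bd i) m'); first exact: se_prj se _ _ Cm'.
    rewrite (se_prjD se Cm') dm' linearB /= pm.
    by move: pn'' => /= ->; rewrite subr0.
Qed.

(** Hochster's formula, for the squarefree part of any graded ideal. The cohomology
    is compared with a subquotient Z / B of a finite-dimensional space because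
    cochain complexes carry no dimension here. *)
Theorem betti_cohom i (V : vectType k) (Z B : {vspace V}) :
  sq_iso (cohom (fam_cochains k U_convex) (#|R|%:Z - 1 - i%:Z))
    (sq_of_vspace Z B) ->
  betti F (chi R) i = \dim (Z :\: B).
Proof.
move=> iso; rewrite /betti; case: i iso => [|i] iso; apply: sq_iso_dim.
  apply: sq_iso_trans (sq_iso_sym Tor0_iso) _.
  by move: iso; rewrite subr0.
apply: sq_iso_trans (sq_iso_sym (TorS_iso i)) _.
apply: sq_iso_trans (sq_iso_sym (syz_shift_iter i)) _.
by move: iso; rewrite -addn1 PoszD opprD [- _ - 1]addrC addrA.
Qed.

End BettiNumbers.

(** * Reduced cohomology as cohomology of a family *)

Section ReducedCohomology.
Variables (k : fieldType) (V : finType) (K : scomplex V).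

Lemma scomplex_convex : convex_family (faces K).
Proof. by apply: convex_down => A B; apply: facesS. Qed.

Definition cval d (u : cochain k K d) : {ffun {set V} -> k^o} :=
  [ffun A => cochain_val u A].

Fact cval_is_linear d : linear (@cval d).
Proof.
move=> a u w; apply/ffunP=> A; rewrite !ffunE /cochain_val.
by case: insub => [s|] /=; rewrite ?ffunE // scaler0 addr0.
Qed.

HB.instance Definition _ d :=
  GRing.isLinear.Build k (cochain k K d) {ffun {set V} -> k^o} _ (@cval d)
    (@cval_is_linear d).

Lemma cval_inj d : injective (@cval d).
Proof.
move=> u w /ffunP eq_uw; apply/ffunP=> s; have := eq_uw (val s).
by rewrite !ffunE /cochain_val valK.
Qed.

Lemma cval_deg d u : cdeg (fam_cochains k scomplex_convex) d (@cval d u).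
Proof.
apply/fam_degP=> A; rewrite ffunE /cochain_val.
by case: insubP => [s /andP[KA /eqP dA] _ _|]; rewrite ?eqxx.
Qed.

Lemma cval_onto d w : cdeg (fam_cochains k scomplex_convex) d w ->
  exists u, @cval d u = w.
Proof.
move/fam_degP=> Cw; exists [ffun s => w (val s)]; apply/ffunP=> A.
rewrite ffunE /cochain_val; case: insubP => [s _ <-|nA] /=; first by rewrite ffunE.
by apply/esym/eqP; apply: contraNT nA => /Cw[-> ->]; rewrite eqxx.
Qed.

Lemma cval_coboundary d e (u : cochain k K d) : e = d + 1 ->
  cval (coboundary k K d e u) = delta (faces K) (cval u).
Proof.
move=> ed; have /fam_degP Cdu := cdiff_deg (cval_deg u).
apply/ffunP=> A; rewrite [LHS]ffunE /cochain_val.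
case: insubP => [s /andP[KA _] <-|nA] /=.
  rewrite lfunE /= !ffunE (andP (valP s)).1; apply: eq_bigr => v _.
  by rewrite ffunE.
apply/esym/eqP; apply: contraNT nA => /Cdu[-> ->]; by rewrite ed eqxx.
Qed.

Lemma red_cohomology_iso d :
  sq_iso (sq_of_vspace (lker (coboundary k K d (d + 1)))
      (limg (coboundary k K (d - 1) d)))
    (cohom (fam_cochains k scomplex_convex) d).
Proof.
apply: (@sq_iso_map k (sq_of_vspace _ _)
  (cohom (fam_cochains k scomplex_convex) d) (@cval d)) => /=.
- by move=> a x y Zx Zy; rewrite rpredD // rpredZ.
- move=> u; rewrite memv_ker => /eqP u0; split; first exact: cval_deg.
  by rewrite /= -(@cval_coboundary _ (d + 1)) // u0 linear0.
- move=> w [Cw w0]; have [u eu] := cval_onto Cw; exists u => //.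
  rewrite memv_ker; apply/eqP/cval_inj.
  by rewrite cval_coboundary // eu linear0.
- move=> u _; split=> [/memv_imgP[w _ ->] | [w /cval_onto[w' <-] dw]].
    exists (cval w); first exact: cval_deg.
    by rewrite /= cval_coboundary // subrK.
  apply/memv_imgP; exists w'; first exact: memvf.
  by apply: cval_inj; rewrite -dw cval_coboundary // subrK.
Qed.

End ReducedCohomology.

(** A relabelling of the vertices that preserves the signs, hence their order. *)
Section Relabelling.
Variables (k : fieldType) (V T : finType) (f : V -> T).
Hypothesis f_inj : injective f.
Hypothesis f_inc : forall (A : {set V}) v,
  incidence k (f @: A) (f v) = incidence k A v.
Variables (K : {set {set V}}) (G : {set {set T}}).
Variables (cK : convex_family K) (cG : convex_family G).
Hypothesis eG : G = (fun A : {set V} => f @: A) @: K.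

Definition pull (u : {ffun {set T} -> k^o}) : {ffun {set V} -> k^o} :=
  [ffun A : {set V} => u (f @: A)].

Fact pull_is_linear : linear pull.
Proof. by move=> a u w; apply/ffunP=> A; rewrite !ffunE. Qed.

HB.instance Definition _ :=
  GRing.isLinear.Build k {ffun {set T} -> k^o} {ffun {set V} -> k^o} _ pull
    pull_is_linear.

Lemma mem_imset_family (A : {set V}) : (f @: A \in G) = (A \in K).
Proof. by rewrite eG mem_imset //; apply: imset_inj. Qed.

Lemma pull_delta u : pull (delta G u) = delta K (pull u).
Proof.
apply/ffunP=> A; rewrite !ffunE mem_imset_family; case: ifP => // _.
rewrite big_imset /=; last by move=> ? ? _ _; apply: f_inj.
apply: eq_bigr => v Av; rewrite ffunE f_inc; congr (_ *: u _).
apply/setP=> x; rewrite !inE; apply/andP/imsetP => [[nx /imsetP[y Ay ex]]|].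
  by exists y => //; rewrite !inE Ay andbT; apply: contraNneq nx => <-; rewrite ex.
case=> y; rewrite !inE => /andP[ney Ay] ->.
by rewrite (inj_eq f_inj) ney imset_f.
Qed.

Lemma pull_deg d u :
  cdeg (fam_cochains k cG) d u -> cdeg (fam_cochains k cK) d (pull u).
Proof.
move/fam_degP=> Cu; apply/fam_degP=> A; rewrite ffunE => /Cu[].
by rewrite mem_imset_family card_imset.
Qed.

Lemma pull_inj d u : cdeg (fam_cochains k cG) d u -> pull u = 0 -> u = 0.
Proof.
move/fam_degP=> Cu /ffunP pu0; apply/ffunP=> B; rewrite ffunE; apply/eqP.
apply: contraT => nz; have [] := Cu B nz; rewrite eG => /imsetP[A _ eB] _.
by have := pu0 A; rewrite !ffunE -eB => /eqP; rewrite (negPf nz).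
Qed.

Lemma preim_imset (A : {set V}) : f @^-1: (f @: A) = A.
Proof. by apply/setP=> x; rewrite inE mem_imset. Qed.

Lemma pull_onto d w : cdeg (fam_cochains k cK) d w ->
  exists2 u, cdeg (fam_cochains k cG) d u & pull u = w.
Proof.
move/fam_degP=> Cw.
exists [ffun B : {set T} => if B \in G then w (f @^-1: B) else 0].
  apply/fam_degP=> B; rewrite ffunE; case: ifP => [GB|]; last by rewrite eqxx.
  move=> /Cw[]; move: GB; rewrite eG => /imsetP[A KA ->].
  by rewrite preim_imset card_imset // => _ ->.
apply/ffunP=> A; rewrite !ffunE mem_imset_family preim_imset.
by case: ifP => // nKA; apply/esym/eqP; apply: contraFT nKA => /Cw[].
Qed.

Lemma relabel_iso d :
  sq_iso (cohom (fam_cochains k cG) d) (cohom (fam_cochains k cK) d).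
Proof.
apply: (@sq_iso_map k (cohom (fam_cochains k cG) d)
  (cohom (fam_cochains k cK) d) pull) => /=.
- by move=> *; apply: cocycleL.
- move=> u [Cu u0]; split; first exact: pull_deg.
  by rewrite /= -pull_delta; move: u0 => /= ->; rewrite linear0.
- move=> w [Cw w0]; have [u Cu pu] := pull_onto Cw; exists u => //; split=> //.
  by apply: pull_inj (cdiff_deg Cu) _; rewrite /= pull_delta pu.
- move=> u [Cu _]; split=> [[w Cw <-] | [w /pull_onto[w' Cw' <-] dw]].
    by exists (pull w); [apply: pull_deg | rewrite /= pull_delta].
  exists w' => //; apply/eqP; rewrite -subr_eq0; apply/eqP.
  apply: (pull_inj (cdegB (cdiff_deg1 Cw') Cu)).
  by rewrite linearB /= pull_delta; move: dw => /= ->; rewrite subrr.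
Qed.

End Relabelling.

(** * Suspensions and folds *)

Section Suspension.
Variables (k : fieldType) (T : finType) (X : {set {set T}}) (S : {set T}).
Hypothesis X_down : forall A B : {set T}, A \subset B -> B \in X -> A \in X.
Hypothesis S_neq0 : S != set0.
Hypothesis S_simplex : forall B : {set T}, B \subset S -> B \in X.
Hypothesis X_bip : forall (B : {set T}) a,
  B \in X -> a \notin S -> a |: (B :&: S) \in X -> a |: B \in X.

Definition link_family : {set {set T}} :=
  [set B : {set T} | (B \subset S) && [exists a, (a \notin S) && (a |: B \in X)]].

Lemma link_family_down (A B : {set T}) :
  A \subset B -> B \in link_family -> A \in link_family.
Proof.
move=> sAB; rewrite !inE => /andP[sBS /existsP[a /andP[nSa Xa]]].
rewrite (subset_trans sAB sBS); apply/existsP; exists a; rewrite nSa.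
by apply: X_down Xa; apply: setUS.
Qed.

(** Let U consist of the faces of X not contained in S. The faces outside U form
    the simplex on S, so U computes the cohomology of X. On the other hand U is
    the complement of the family Y = [link_family] in the faces of X whose
    trace on S lies in Y; these are acyclic, because over a fixed trace they
    form a cone. The two steps together make X a suspension of Y. *)
Lemma suspension_iso (cX : convex_family X) (cY : convex_family link_family) d :
  sq_iso (cohom (fam_cochains k cX) (d + 1)) (cohom (fam_cochains k cY) d).
Proof.
pose U := [set B in X | ~~ (B \subset S)].
pose W := [set B in X | B :&: S \in link_family].
have sUX : U \subset X by apply/subsetP=> B; rewrite inE => /andP[].
have upUX (A B : {set T}) : A \subset B -> A \in U -> B \in X -> B \in U.
  move=> sAB; rewrite !inE => /andP[_ nAS] ->.
  by apply: contra nAS; apply: subset_trans.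
have sUW : U \subset W.
  apply/subsetP=> B; rewrite !inE => /andP[XB /subsetPn[a Ba nSa]].
  rewrite XB subsetIr; apply/existsP; exists a; rewrite nSa.
  by apply: X_down XB; rewrite subUset sub1set Ba subsetIl.
have upUW (A B : {set T}) : A \subset B -> A \in U -> B \in W -> B \in U.
  by move=> sAB UA; rewrite inE => /andP[XB _]; apply: upUX UA XB.
have cU := convex_up cX sUX upUX.
have cW : convex_family W.
  apply: convex_down => A B sAB; rewrite !inE => /andP[XB YB].
  rewrite (X_down sAB XB); have := @link_family_down (A :&: S) (B :&: S).
  by rewrite setSI // !inE => ->.
have eS : powerset S = X :\: U.
  apply/setP=> B; rewrite !inE negb_and negbK; apply/idP/andP => [sBS|].
    by rewrite sBS orbT S_simplex.
  by case=> /orP[/negPf->|].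
have eY : link_family = W :\: U.
  apply/setP=> B; rewrite [RHS]inE [B \in U]inE [B \in W]inE.
  rewrite negb_and negbK; apply/idP/andP.
    move=> YB; have sBS : B \subset S by move: YB; rewrite inE => /andP[].
    by rewrite (setIidPl sBS) sBS orbT S_simplex.
  case=> /orP[/negPf->//|sBS] /andP[_]; by rewrite (setIidPl sBS).
have acS e : acyclic (fam_cochains k (powerset_convex (R := S))) e.
  have [b Sb] := set0Pn _ S_neq0; apply: (@cone_acyclic _ _ _ _ b) => B _.
  by rewrite !inE subUset sub1set Sb.
have acW e : acyclic (fam_cochains k cW) e.
  apply: (@fibrewise_cone_acyclic _ _ S) => A; rewrite !inE => /andP[XA].
  case/andP=> _ /existsP[a /andP[nSa XaA]]; exists a => // B eB nBa.
  have eaB : (a |: B) :&: S = B :&: S.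
    apply/setP=> x; rewrite !inE; case: eqVneq => // ->.
    by rewrite (negPf nSa) !andbF.
  rewrite !inE eaB; congr (_ && _); apply/idP/idP; first exact/X_down/subsetU1.
  by move=> XB; apply: X_bip => //; rewrite eB.
have seX := fam_short_exact k cX cU (powerset_convex (R := S)) sUX upUX eS.
have seW := fam_short_exact k cW cU cY sUW upUW eY.
apply: sq_iso_trans (sq_iso_sym (subcomplex_iso seX (acS _) (acS _))) _.
exact: sq_iso_sym (connecting_iso seW (acW _) (acW _)).
Qed.

End Suspension.

(** The hypothesis says that every vertex z outside V is dominated by some vertex
    v of V. A face not contained in V contains such a z, and then v is an apex of
    the fibre over its trace on the complement of V; so the faces not contained
    in V form an acyclic family. *)
Lemma fold_iso (k : fieldType) (T : finType) (D E : {set {set T}}) (V : {set T})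
    (cD : convex_family D) (cE : convex_family E) :
  (forall A B : {set T}, A \subset B -> B \in D -> A \in D) ->
  E = [set B in D | B \subset V] ->
  (forall z, z \notin V -> [set z] \in D -> exists2 v, v \in V &
     forall C : {set T}, z \in C -> C \in D -> v |: C \in D) ->
  forall d, sq_iso (cohom (fam_cochains k cD) d) (cohom (fam_cochains k cE) d).
Proof.
move=> D_down eE dom d.
pose U := [set B in D | ~~ (B \subset V)].
have sUD : U \subset D by apply/subsetP=> B; rewrite inE => /andP[].
have upU (A B : {set T}) : A \subset B -> A \in U -> B \in D -> B \in U.
  move=> sAB; rewrite !inE => /andP[_ nAV] ->.
  by apply: contra nAV; apply: subset_trans.
have cU := convex_up cD sUD upU.
have eD : E = D :\: U.
  apply/setP=> B; rewrite eE !inE negb_and negbK.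
  by case: (B \in D); rewrite ?andbF // andbT.
have acU e : acyclic (fam_cochains k cU) e.
  apply: (@fibrewise_cone_acyclic _ _ (~: V)) => A; rewrite inE.
  case/andP=> DA /subsetPn[z Az nVz].
  have Dz : [set z] \in D by apply: D_down DA; rewrite sub1set.
  have [v Vv cone] := dom z nVz Dz.
  exists v => [|B eB nBv]; first by rewrite inE negbK.
  have Bz : z \in B.
    have : z \in A :&: ~: V by rewrite !inE Az.
    by rewrite -eB inE => /andP[].
  have nBV : ~~ (B \subset V) by apply/subsetPn; exists z.
  rewrite !inE subUset (negPf nBV) !andbF !andbT.
  apply/idP/idP; first exact/D_down/subsetU1.
  exact: cone.
exact: (quotient_iso (fam_short_exact k cD cU cE sUD upU eD) (acU _) (acU _)).
Qed.

Section EnumRankPair.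
Variables T1 T2 : finType.

Lemma enum_rank_index (T : finType) (x : T) : enum_rank x = index x (enum T) :> nat.
Proof.
rewrite -{2}[x](nth_enum_rank x) index_uniq ?enum_uniq //.
by rewrite -cardE; apply: ltn_ord.
Qed.

Lemma index_allpairs_lt (s : seq T1) (t : seq T2) a x y :
  x \in t -> y \in t -> a \in s ->
  (index (a, x) [seq (b, z) | b <- s, z <- t] <
   index (a, y) [seq (b, z) | b <- s, z <- t])%N = (index x t < index y t)%N.
Proof.
move=> tx ty; have pairI b : injective (pair b : T2 -> T1 * T2) by move=> ? ? [].
elim: s => //= b s IH; rewrite inE !index_cat.
case: (eqVneq a b) => [<- _ | neab /= sa].
  by rewrite !map_f // !(index_map (pairI a)).
have notin z : (a, z) \in [seq (b, y) | y <- t] = false.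
  by apply/mapP=> -[? _ [eab]]; rewrite eab eqxx in neab.
by rewrite !notin ltn_add2l IH.
Qed.

(** Pairs are enumerated lexicographically, so that the vertices (a, x) come in
    the order of the vertices x and the signs agree. *)
Lemma enum_rank_pair_lt (a : T1) (x y : T2) :
  (enum_rank (a, x) < enum_rank (a, y))%N = (enum_rank x < enum_rank y)%N.
Proof.
rewrite !enum_rank_index [enum {: _ * _}]enumT unlock.
by rewrite index_allpairs_lt ?mem_enum.
Qed.

Lemma incidence_pair (k : fieldType) (a : T1) (A : {set T2}) x :
  incidence k (pair a @: A) (a, x) = incidence k A x.
Proof.
rewrite /incidence; congr (_ ^+ _).
have pairI : injective (pair a : T2 -> T1 * T2) by move=> ? ? [].
rewrite -[RHS](card_imset _ pairI).
apply: eq_card => z; rewrite !inE; apply/andP/imsetP.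
  case=> /imsetP[y Ay ->]; rewrite enum_rank_pair_lt => lt.
  by exists y; rewrite // inE Ay.
case=> y; rewrite inE => /andP[Ay lt] ->.
by rewrite enum_rank_pair_lt lt imset_f.
Qed.

End EnumRankPair.

(** * The letterplace ideal *)

Section Extremal.
Variables (disp : Order.disp_t) (P : finPOrderType disp).
Implicit Types (A : {set P}) (p q : P).

Lemma exists_max_elt A p : p \in A -> exists2 q, q \in max_elts A & (p <= q)%O.
Proof.
move=> Ap; have Qp : (p \in A) && (p <= p)%O by rewrite Ap lexx.
case: (@arg_maxnP _ p (fun q => (q \in A) && (p <= q)%O)
  (fun q => #|[set x | (x <= q)%O]|) Qp) => q /andP[Aq lepq] maxq.
exists q => //; rewrite inE Aq; apply/forall_inP => r Ar; apply/implyP => leqr.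
have sub : [set x | (x <= q)%O] \subset [set x | (x <= r)%O].
  by apply/subsetP=> x; rewrite !inE => /le_trans; apply.
have := maxq r; rewrite Ar (le_trans lepq leqr) => /(_ isT) ge.
have /eqP/setP/(_ r) : [set x | (x <= q)%O] == [set x | (x <= r)%O].
  by rewrite eqEcard sub.
by rewrite !inE lexx eq_le leqr andbT.
Qed.

Lemma exists_min_elt A p : p \in A -> exists2 q, q \in min_elts A & (q <= p)%O.
Proof.
move=> Ap; have Qp : (p \in A) && (p <= p)%O by rewrite Ap lexx.
case: (@arg_maxnP _ p (fun q => (q \in A) && (q <= p)%O)
  (fun q => #|[set x | (q <= x)%O]|) Qp) => q /andP[Aq leqp] maxq.
exists q => //; rewrite inE Aq; apply/forall_inP => r Ar; apply/implyP => lerq.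
have sub : [set x | (q <= x)%O] \subset [set x | (r <= x)%O].
  by apply/subsetP=> x; rewrite !inE; apply: le_trans.
have := maxq r; rewrite Ar (le_trans lerq leqp) => /(_ isT) ge.
have /eqP/setP/(_ r) : [set x | (q <= x)%O] == [set x | (r <= x)%O].
  by rewrite eqEcard sub.
by rewrite !inE lexx eq_le lerq.
Qed.

End Extremal.

Section LetterplaceBetti.
Variables (k : fieldType) (disp : Order.disp_t) (P : finPOrderType disp).
Local Notation T := ('I_2 * P)%type.
Local Notation fst_letter := (@fst_letter disp P).
Local Notation snd_letter := (@snd_letter disp P).
Implicit Types (B : {set T}) (p q : P).

Definition has_edge B :=
  [exists p, exists q, [&& fst_letter p \in B, snd_letter q \in B & (p <= q)%O]].

Lemma has_edgeP B : reflect
  (exists p q, [/\ fst_letter p \in B, snd_letter q \in B & (p <= q)%O])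
  (has_edge B).
Proof.
apply: (iffP existsP) => [[p /existsP[q /and3P[]]]|[p [q [Bp Bq le]]]].
  by exists p, q.
by exists p; apply/existsP; exists q; apply/and3P.
Qed.

Lemma fst_neq_snd p q : (fst_letter p == snd_letter q) = false.
Proof. by rewrite xpair_eqE andFb. Qed.

Lemma letter_cases (z : T) :
  (exists p, z = fst_letter p) \/ (exists p, z = snd_letter p).
Proof.
case: z => [[[|[|//]] lti] p]; [left | right]; exists p;
  by rewrite /fst_letter /snd_letter; congr (_, _); apply: val_inj.
Qed.

Lemma edge_monomial p q :
  lp_var k (fst_letter p) * lp_var k (snd_letter q)
  = 'X_[U_(enum_rank (fst_letter p)) + U_(enum_rank (snd_letter q))].
Proof. by rewrite mpolyXD. Qed.

Lemma edge_le_chi p q B :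
  (U_(enum_rank (fst_letter p)) + U_(enum_rank (snd_letter q)) <= chi B)%MM
  = (fst_letter p \in B) && (snd_letter q \in B).
Proof.
apply/le_chiP/andP => [le | [Bp Bq] v].
  have := le (fst_letter p); have := le (snd_letter q).
  by rewrite !mnmE !eqxx addn1 add1n; do 2!case: (_ \in B).
rewrite !mnmE !(inj_eq enum_rank_inj).
case: (eqVneq (fst_letter p) v) => [<-|_].
  by rewrite Bp [_ == fst_letter p]eq_sym fst_neq_snd.
by case: (eqVneq (snd_letter q) v) => // <-; rewrite Bq.
Qed.

(** A squarefree monomial lies in the letterplace ideal iff a generator divides
    it. *)
Lemma letterplace_monomial B :
  letterplace ('X_[chi B] : {mpoly k[_]}) <-> has_edge B.
Proof.
split=> [[c ec] | /has_edgeP[p [q [Bp Bq lepq]]]].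
  apply: contraT => /has_edgeP noE.
  have : ('X_[chi B] : {mpoly k[#|{: T}|]})@_(chi B) = 0.
    rewrite ec raddf_sum big1 // => p _; rewrite raddf_sum big1 // => q lepq /=.
    rewrite edge_monomial mcoeffMX_out // edge_le_chi.
    by apply/andP=> -[Bp Bq]; apply: noE; exists p, q.
  by rewrite mcoeffX eqxx => /eqP; rewrite oner_eq0.
pose e := (U_(enum_rank (fst_letter p)) + U_(enum_rank (snd_letter q)))%MM.
exists (fun x y => if (x == p) && (y == q) then 'X_[chi B - e] else 0).
rewrite (bigD1 p) //= (bigD1 q) //= !eqxx edge_monomial -mpolyXD.
rewrite submK ?edge_le_chi ?Bp // !big1 ?addr0 //.
  by move=> x nex; apply: big1 => y _; rewrite (negPf nex) mul0r.
by move=> y /andP[_ /negPf->]; rewrite mul0r.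
Qed.

Variables (R1 R2 : {set P}).
Local Notation R := (letters R1 R2).
Local Notation XV := (X_vertices R1 R2).
Local Notation X := (X_complex R1 R2).

Lemma fst_letter_inj : injective fst_letter. Proof. by move=> p q []. Qed.
Lemma snd_letter_inj : injective snd_letter. Proof. by move=> p q []. Qed.

Lemma mem_fst_letters p (A1 A2 : {set P}) :
  (fst_letter p \in fst_letter @: A1 :|: snd_letter @: A2) = (p \in A1).
Proof.
rewrite inE (mem_imset _ _ fst_letter_inj) orbC.
case: imsetP => [[q _ /eqP]|//]; by rewrite fst_neq_snd.
Qed.

Lemma mem_snd_letters p (A1 A2 : {set P}) :
  (snd_letter p \in fst_letter @: A1 :|: snd_letter @: A2) = (p \in A2).
Proof.
rewrite inE (mem_imset _ _ snd_letter_inj).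
by case: imsetP => [[q _ /esym/eqP]|//]; rewrite fst_neq_snd.
Qed.

Definition edge_family := [set B in powerset R | has_edge B].
Definition independent_family := powerset R :\: edge_family.

Lemma independentP B : (B \in independent_family) = (B \subset R) && ~~ has_edge B.
Proof. by rewrite !inE; case: (B \subset R); rewrite ?andbF ?andbT. Qed.

Lemma has_edgeS (A B : {set T}) : A \subset B -> has_edge A -> has_edge B.
Proof.
move=> sAB /has_edgeP[p [q [Ap Aq le]]]; apply/has_edgeP; exists p, q.
by split=> //; apply: (subsetP sAB).
Qed.

Lemma independent_down (A B : {set T}) :
  A \subset B -> B \in independent_family -> A \in independent_family.
Proof.
move=> sAB; rewrite !independentP => /andP[sBR nEB].
by rewrite (subset_trans sAB sBR); apply: contra nEB; apply: has_edgeS.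
Qed.

Lemma edge_familyP B :
  B \in edge_family <-> B \subset R /\ letterplace ('X_[chi B] : {mpoly k[_]}).
Proof.
by rewrite letterplace_monomial inE inE; split=> [/andP//|[-> ->]].
Qed.

Lemma X_vertices_sub : XV \subset R.
Proof.
apply/subsetP=> z; case: (letter_cases z) => -[p ->].
  by rewrite !mem_fst_letters inE => /andP[].
by rewrite !mem_snd_letters inE => /andP[].
Qed.

Lemma X_facesE : X_faces R1 R2 = [set B in independent_family | B \subset XV].
Proof.
apply/setP=> B; rewrite [RHS]inE independentP inE.
case: (boolP (B \subset XV)) => [sBX|]; last by rewrite andbF.
rewrite (subset_trans sBX X_vertices_sub) andbT /=.
rewrite negb_exists; apply: eq_forallb => p; rewrite negb_exists.
by apply: eq_forallb => q; rewrite andbA negb_and implybE.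
Qed.

(** Deleting a non-maximal p from R1 folds it onto a maximal element above it,
    whose neighbours are among those of p; dually for R2. *)
Lemma letterplace_fold (cI : convex_family independent_family)
    (cX : convex_family (X_faces R1 R2)) d :
  sq_iso (cohom (fam_cochains k cI) d) (cohom (fam_cochains k cX) d).
Proof.
apply: (@fold_iso k _ _ _ XV cI cX independent_down X_facesE _ d) => z nVz.
rewrite independentP sub1set => /andP[Rz _].
have add_vertex v B : v \in R -> B \in independent_family ->
    (has_edge (v |: B) -> has_edge B) -> v |: B \in independent_family.
  move=> Rv; rewrite !independentP subUset sub1set Rv => /andP[-> nE] imp /=.
  by apply: contra nE.
case: (letter_cases z) => -[p ez]; rewrite {z}ez in nVz Rz *.
  rewrite mem_fst_letters in Rz; have [p' maxp' lepp'] := exists_max_elt Rz.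
  have Vp' : fst_letter p' \in XV by rewrite mem_fst_letters.
  exists (fst_letter p') => // C Cp IC; apply: add_vertex => //.
    exact: (subsetP X_vertices_sub).
  case/has_edgeP=> x [y []]; rewrite !inE [snd_letter y == _]eq_sym fst_neq_snd /=.
  case/orP=> [/eqP[->]|Cx] Cy le; last by apply/has_edgeP; exists x, y.
  by apply/has_edgeP; exists p, y; split=> //; apply: le_trans le.
rewrite mem_snd_letters in Rz; have [p' minp' lepp'] := exists_min_elt Rz.
have Vp' : snd_letter p' \in XV by rewrite mem_snd_letters.
exists (snd_letter p') => // C Cp IC; apply: add_vertex => //.
  exact: (subsetP X_vertices_sub).
case/has_edgeP=> x [y []]; rewrite !inE fst_neq_snd /= => Cx.
case/orP=> [/eqP[->]|Cy] le; last by apply/has_edgeP; exists x, y.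
by apply/has_edgeP; exists x, p; split=> //; apply: le_trans lepp'.
Qed.

(** For nonempty R the powerset of R is acyclic, hence the shift by one; for
    empty R neither family has a set in the degrees considered. *)
Lemma edge_X_iso (cU : convex_family edge_family)
    (cX : convex_family (X_faces R1 R2)) i :
  sq_iso (cohom (fam_cochains k cU) (#|R|%:Z - 1 - i%:Z))
    (cohom (fam_cochains k cX) (#|R|%:Z - i%:Z - 2)).
Proof.
have [R0 | [v Rv]] := set_0Vmem R.
  apply: cohom_acyclic_iso; apply: empty_degree_acyclic => B.
    rewrite inE powersetE R0 subset0 => /andP[/eqP-> /has_edgeP[p [q []]]].
    by rewrite inE.
  by move=> _; rewrite R0 cards0; case: i.
have sU : edge_family \subset powerset R.
  by apply/subsetP=> B; rewrite inE => /andP[].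
have upU (A B : {set T}) : A \subset B -> A \in edge_family ->
    B \in powerset R -> B \in edge_family.
  by move=> sAB; rewrite !inE => /andP[_ EA] ->; apply: has_edgeS EA.
have cI := convex_down independent_down.
have acR d : acyclic (fam_cochains k (powerset_convex (R := R))) d.
  apply: (@cone_acyclic _ _ _ _ v) => B _.
  by rewrite !inE subUset sub1set Rv.
have se := fam_short_exact k (powerset_convex (R := R)) cU cI sU upU erefl.
have -> : #|R|%:Z - 1 - i%:Z = #|R|%:Z - i%:Z - 2 + 1.
  by rewrite -[RHS]addrA (_ : - 2 + 1 = - 1 :> int) // addrAC.
apply: sq_iso_trans (sq_iso_sym (connecting_iso se (acR _) (acR _))) _.
exact: letterplace_fold.
Qed.


Lemma X_facesP B : (B \in X_faces R1 R2) = (B \subset XV) && ~~ has_edge B.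
Proof.
rewrite X_facesE inE independentP andbC; case: (boolP (B \subset XV)) => //= sBX.
by rewrite (subset_trans sBX X_vertices_sub).
Qed.

(** One side of the bipartite graph: [f] and [g] embed the two sides and [e] is
    the adjacency relation. In a bipartite graph, adding a vertex on one side
    only creates edges with the other side. *)
Lemma side_suspension (f g : P -> T) (A B : {set P}) (e : rel P)
    (Y : {set {set P}}) (cX : convex_family (X_faces R1 R2))
    (cY : convex_family Y) d :
    injective f -> injective g -> (forall p q, f p != g q) ->
    (forall z, (exists p, z = f p) \/ (exists p, z = g p)) ->
    (forall (C : {set P}) p, incidence k (f @: C) (f p) = incidence k C p) ->
    (forall p, (f p \in XV) = (p \in A)) -> (forall p, (g p \in XV) = (p \in B)) ->
    (forall C, has_edge C <-> exists p q, [/\ f p \in C, g q \in C & e p q]) ->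
    Y = [set C : {set P} | (C \subset A) &&
      [exists b in B, forall a in C, ~~ e a b]] ->
    A != set0 ->
  sq_iso (cohom (fam_cochains k cX) (d + 1)) (cohom (fam_cochains k cY) d).
Proof.
move=> f_inj g_inj f_neq_g fg f_inc Vf Vg edgeP eY /set0Pn[m Am].
pose S := f @: A.
have mem_S p : (f p \in S) = (p \in A) by apply: mem_imset.
have g_img p (C : {set P}) : (g p \in f @: C) = false.
  by apply/imsetP=> -[q _ /esym/eqP]; rewrite (negPf (f_neq_g _ _)).
have sSV : S \subset XV by apply/subsetP=> _ /imsetP[p Ap ->]; rewrite Vf.
have S_neq0 : S != set0 by apply/set0Pn; exists (f m); rewrite mem_S.
have S_simplex (C : {set T}) : C \subset S -> C \in X_faces R1 R2.
  move=> sCS; rewrite X_facesP (subset_trans sCS sSV); apply/negP=> /edgeP.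
  by case=> p [q [_ /(subsetP sCS)]]; rewrite g_img.
have not_S a : a \notin S -> a \in XV -> exists2 q, q \in B & a = g q.
  case: (fg a) => -[q ->]; first by rewrite Vf mem_S => /negPf->.
  by rewrite Vg; exists q.
have X_bip (C : {set T}) a : C \in X_faces R1 R2 -> a \notin S ->
    a |: (C :&: S) \in X_faces R1 R2 -> a |: C \in X_faces R1 R2.
  rewrite !X_facesP !subUset !sub1set => /andP[sCV nEC] nSa.
  case/andP=> /andP[Va _] nEa; rewrite Va sCV /=; apply/negP=> /edgeP.
  have [q _ ea] := not_S a nSa Va; rewrite {a}ea in nSa Va nEa *.
  case=> x [y [Cx Cy le]]; move: Cx Cy; rewrite !inE (negPf (f_neq_g _ _)) /=.
  move=> Cx /orP[/eqP ey|Cy]; last by case/negP: nEC; apply/edgeP; exists x, y.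
  case/negP: nEa; apply/edgeP; exists x, y; rewrite ey !inE eqxx Cx.
  by split; rewrite // mem_S -Vf (subsetP sCV _ Cx) orbT.
have X_down := @X_facesS disp P R1 R2.
have eL : link_family (X_faces R1 R2) S = (fun C : {set P} => f @: C) @: Y.
  apply/setP=> C; rewrite inE eY; apply/andP/imsetP => [[sCS /existsP[a]]|[D]].
    case/andP=> nSa; rewrite X_facesP subUset sub1set.
    case/andP=> /andP[Va _] /negP nE.
    have [q Bq ea] := not_S a nSa Va.
    exists (f @^-1: C); last first.
      apply/setP=> z; apply/idP/imsetP=> [Cz|[p + ->]]; last by rewrite inE.
      by have /imsetP[p _ ez] := subsetP sCS z Cz; exists p; rewrite // inE -ez.
    rewrite inE; apply/andP; split.
      by apply/subsetP=> p; rewrite inE => /(subsetP sCS); rewrite mem_S.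
    apply/exists_inP; exists q => //; apply/forall_inP=> p; rewrite inE => Cp.
    apply/negP=> le; apply: nE; apply/edgeP; exists p, q.
    by rewrite !inE ea eqxx Cp orbT.
  rewrite inE => /andP[sDA /exists_inP[q Bq /forall_inP nle]] ->.
  split; first exact: imsetS.
  apply/existsP; exists (g q); rewrite g_img X_facesP subUset sub1set Vg Bq.
  rewrite (subset_trans (imsetS _ sDA) sSV) /=; apply/negP=> /edgeP[x [y []]].
  rewrite !inE (negPf (f_neq_g _ _)) g_img orbF (mem_imset _ _ f_inj) /= => Dx.
  by move=> /eqP/g_inj->; apply/negP; apply: nle.
have cL := convex_down (link_family_down X_down (S := S)).
apply: sq_iso_trans (suspension_iso k X_down S_neq0 S_simplex X_bip cX cL d) _.
exact: (relabel_iso f_inj f_inc cY cL eL).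
Qed.

Lemma max_elts_neq0 : (max_elts R1 != set0) = (R1 != set0).
Proof.
apply/set0Pn/set0Pn => -[p Rp]; last by have [q] := exists_max_elt Rp; exists q.
by exists p; move: Rp; rewrite inE => /andP[].
Qed.

Lemma min_elts_neq0 : (min_elts R2 != set0) = (R2 != set0).
Proof.
apply/set0Pn/set0Pn => -[p Rp]; last by have [q] := exists_min_elt Rp; exists q.
by exists p; move: Rp; rewrite inE => /andP[].
Qed.

Lemma Y1_suspension (cX : convex_family (X_faces R1 R2))
    (cY : convex_family (Y1_faces R1 R2)) d : R1 != set0 ->
  sq_iso (cohom (fam_cochains k cX) (d + 1)) (cohom (fam_cochains k cY) d).
Proof.
rewrite -max_elts_neq0; apply: (side_suspension (f := fst_letter)
  (g := snd_letter) (B := min_elts R2) (e := fun p q => (p <= q)%O)) => //.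
- exact: fst_letter_inj.
- exact: snd_letter_inj.
- exact: letter_cases.
- exact: incidence_pair.
- by move=> p; rewrite mem_fst_letters.
- by move=> p; rewrite mem_snd_letters.
- by move=> C; split=> /has_edgeP.
Qed.

Lemma Y2_suspension (cX : convex_family (X_faces R1 R2))
    (cY : convex_family (Y2_faces R1 R2)) d : R2 != set0 ->
  sq_iso (cohom (fam_cochains k cX) (d + 1)) (cohom (fam_cochains k cY) d).
Proof.
rewrite -min_elts_neq0; apply: (side_suspension (f := snd_letter)
  (g := fst_letter) (B := max_elts R1) (e := fun p q => (q <= p)%O)) => //.
- exact: snd_letter_inj.
- exact: fst_letter_inj.
- by move=> z; case: (letter_cases z); [right | left].
- exact: incidence_pair.
- by move=> p; rewrite mem_snd_letters.
- by move=> p; rewrite mem_fst_letters.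
- move=> C; split=> [/has_edgeP[p [q []]]|[p [q []]]]; first by exists q, p.
  by move=> Cp Cq le; apply/has_edgeP; exists q, p.
Qed.

End LetterplaceBetti.

Lemma betti_letterplace (k : fieldType) (disp : Order.disp_t)
    (P : finPOrderType disp) (R1 R2 : {set P})
    (F : graded_free_resolution (@letterplace k disp P)) (i : nat) :
  betti F (support_mdeg (letters R1 R2)) i =
  \dim (red_cohomology k (X_complex R1 R2) (#|letters R1 R2|%:Z - i%:Z - 2)).
Proof.
have iso := sq_iso_trans
  (edge_X_iso k (R1 := R1) (R2 := R2) (U_convex F (edge_familyP k R1 R2))
    (scomplex_convex (K := X_complex R1 R2)) i)
  (sq_iso_sym (red_cohomology_iso k (X_complex R1 R2)
    (#|letters R1 R2|%:Z - i%:Z - 2))).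
exact: (betti_cohom iso).
Qed.

(** If R1 and R2 are both empty, neither complex has a face in the degrees
    considered, whether or not X is a suspension of Y. *)
Lemma red_cohomology_shift (k : fieldType) (disp : Order.disp_t)
    (P : finPOrderType disp) (R1 R2 : {set P}) (Y : scomplex P) (i : nat) :
  (R1 :|: R2 != set0 -> forall d, sq_iso
     (cohom (fam_cochains k (scomplex_convex (K := X_complex R1 R2))) (d + 1))
     (cohom (fam_cochains k (scomplex_convex (K := Y))) d)) ->
  vspace_isom
    (red_cohomology k (X_complex R1 R2) (#|letters R1 R2|%:Z - i%:Z - 2))
    (red_cohomology k Y (#|letters R1 R2|%:Z - i%:Z - 3)).
Proof.
move=> susp; apply: vspace_isom_dim; apply: sq_iso_dim.
apply: sq_iso_trans (red_cohomology_iso _ _ _) _.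
apply: sq_iso_trans (sq_iso_sym (red_cohomology_iso _ _ _)).
have [R0|nz] := eqVneq (R1 :|: R2) set0; last first.
  have -> : #|letters R1 R2|%:Z - i%:Z - 2 = #|letters R1 R2|%:Z - i%:Z - 3 + 1.
    by rewrite -[RHS]addrA.
  exact: susp.
have -> : #|letters R1 R2| = 0%N.
  move/eqP: R0; rewrite setU_eq0 => /andP[/eqP-> /eqP->].
  by rewrite /letters !imset0 setU0 cards0.
apply: cohom_acyclic_iso; apply: empty_degree_acyclic => B _; by case: i.
Qed.

Unset Implicit Arguments.

(* If exactly one of R1, R2 is empty, the complex on the empty vertex set is
   {set0}, whose cohomology in degree -1 is nonzero although X is a simplex;
   the two side conditions exclude precisely this case. *)
Theorem theorem3p2 (k : fieldType) (disp : Order.disp_t)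
    (P : finPOrderType disp) (R1 R2 : {set P})
    (F : graded_free_resolution (@letterplace k disp P)) (i : nat) :
  let R := letters R1 R2 in
  let HX := red_cohomology k (X_complex R1 R2) (#|R|%:Z - i%:Z - 2) in
  let HY1 := red_cohomology k (Y1_complex R1 R2) (#|R|%:Z - i%:Z - 3) in
  let HY2 := red_cohomology k (Y2_complex R1 R2) (#|R|%:Z - i%:Z - 3) in
  [/\ betti F (support_mdeg R) i = \dim HX,
      (R1 = set0 -> R2 = set0) -> vspace_isom HX HY1
    & (R2 = set0 -> R1 = set0) -> vspace_isom HX HY2].
Proof.
split=> [|R12|R21]; first exact: betti_letterplace.
  apply: red_cohomology_shift => nz d; apply: Y1_suspension.
  by apply: contraNneq nz => R1_0; rewrite (R12 R1_0) R1_0 setU0.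
apply: red_cohomology_shift => nz d; apply: Y2_suspension.
by apply: contraNneq nz => R2_0; rewrite (R21 R2_0) R2_0 setU0.
Qed.
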